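(* Let $k$ be a field with at least $8$ elements, and let $G$ be an algebraic group over $k$. There exist a finite-dimensional $k$-vector space $V$ and an element $t\in V\otimes V^\vee\otimes V^\vee$ such that $G$ is isomorphic to the subgroup of $\mathrm{GL}_V$ fixing $t$.
   Context: An algebraic group over $k$ is an affine group scheme of finite type over $k$ (not necessarily smooth). $V^\vee$ is the linear dual of $V$. The subgroup of $\mathrm{GL}_V$ fixing $t$ is the algebraic subgroup representing the functor sending a commutative $k$-algebra $R$ to the set of $\alpha\in\mathrm{GL}(R\otimes_k V)$ whose induced action on $R\otimes_k(V\otimes V^\vee\otimes V^\vee)$ fixes $t$. *)

(* Defs.v *)
From HB Require Import structures.
From mathcomp Require Import all_boot all_order all_algebra.
From mathcomp Require Import mxtens.
From mathcomp Require Import mpoly.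

Set Implicit Arguments.
Unset Strict Implicit.
Unset Printing Implicit Defensive.

Import GRing.Theory.
Local Open Scope ring_scope.

(* MathComp algebras are nontrivial rings.  Restricting functors to nonzero
   commutative k-algebras loses nothing for affine group schemes: the
   coordinate ring is nonzero (it has a counit), and the value at the zero
   algebra is always the trivial group. *)
Record group_functor (k : fieldType) := GroupFunctor {
  gf_pts :> comAlgType k -> groupType;
  gf_map : forall R S : comAlgType k,
    {lrmorphism R -> S} -> {multiplicative gf_pts R -> gf_pts S};
  gf_map_ext : forall (R S : comAlgType k) (f g : {lrmorphism R -> S}),
    f =1 g -> gf_map f =1 gf_map g;
  gf_map_id : forall R : comAlgType k,
    gf_map (idfun : {lrmorphism R -> R}) =1 id;
  gf_map_comp : forall (R S T : comAlgType k)
      (g : {lrmorphism S -> T}) (f : {lrmorphism R -> S}),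
    gf_map (g \o f : {lrmorphism R -> T}) =1 gf_map g \o gf_map f
}.

Definition gf_isomorphic (k : fieldType) (F G : group_functor k) : Prop :=
  exists phi : forall R : comAlgType k, {multiplicative F R -> G R},
    (forall R, bijective (phi R)) /\
    (forall (R S : comAlgType k) (f : {lrmorphism R -> S}) (x : F R),
       phi S (gf_map F f x) = gf_map G f (phi R x)).

(* The pair (A, u) represents the underlying set-valued functor of F: the map
   Hom_k-alg(A, R) -> F(R), f |-> F(f)(u), is bijective for every R. *)
Definition represents (k : fieldType) (F : group_functor k)
    (A : comAlgType k) (u : F A) : Prop :=
  forall (R : comAlgType k) (x : F R),
    exists2 f : {lrmorphism A -> R}, gf_map F f u = x
      & forall g : {lrmorphism A -> R}, gf_map F g u = x -> g =1 f.

Definition finite_type_alg (k : fieldType) (A : comAlgType k) : Prop :=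
  exists (m : nat) (h : 'I_m -> A),
    forall a : A, exists p : {mpoly k[m]}, mmap (in_alg A) h p = a.

(* An affine group scheme of finite type, given by its functor of points. *)
Record algebraic_group (k : fieldType) := AlgebraicGroup {
  ag_functor :> group_functor k;
  ag_affine_ft : exists A : comAlgType k,
    finite_type_alg A /\ exists u : ag_functor A, represents u
}.

Section GeneralLinear.
Variables (R : comNzRingType) (n : nat).

(* A commutative ring here need not come with a computable inverse (unitmx is
   not available), so an element of GL_n(R) carries its inverse matrix. *)
Record GL := MkGL {
  gl_pair : 'M[R]_n * 'M[R]_n;
  _ : (gl_pair.1 *m gl_pair.2 == 1%:M) && (gl_pair.2 *m gl_pair.1 == 1%:M)
}.
HB.instance Definition _ := [isSub for gl_pair].
HB.instance Definition _ := [Choice of GL by <:].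

Definition gl_mx (a : GL) : 'M[R]_n := (gl_pair a).1.
Definition gl_invmx (a : GL) : 'M[R]_n := (gl_pair a).2.

Lemma gl_mulmxV a : gl_mx a *m gl_invmx a = 1%:M.
Proof. by case: a => p pP; case/andP: (pP) => /eqP. Qed.

Lemma gl_mulVmx a : gl_invmx a *m gl_mx a = 1%:M.
Proof. by case: a => p pP; case/andP: (pP) => _ /eqP. Qed.

Lemma gl_one_subproof :
  ((1%:M : 'M[R]_n) *m 1%:M == 1%:M) && ((1%:M : 'M[R]_n) *m 1%:M == 1%:M).
Proof. by rewrite mulmx1 eqxx. Qed.
Definition gl_one := @MkGL (1%:M, 1%:M) gl_one_subproof.

Lemma gl_inv_subproof a :
  (gl_invmx a *m gl_mx a == 1%:M) && (gl_mx a *m gl_invmx a == 1%:M).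
Proof. by rewrite gl_mulmxV gl_mulVmx !eqxx. Qed.
Definition gl_inv a := @MkGL (gl_invmx a, gl_mx a) (gl_inv_subproof a).

Lemma gl_mul_subproof a b :
  ((gl_mx a *m gl_mx b) *m (gl_invmx b *m gl_invmx a) == 1%:M) &&
  ((gl_invmx b *m gl_invmx a) *m (gl_mx a *m gl_mx b) == 1%:M).
Proof.
rewrite !mulmxA -[gl_mx a *m _ *m _]mulmxA gl_mulmxV mulmx1 gl_mulmxV.
by rewrite -[gl_invmx b *m _ *m _]mulmxA gl_mulVmx mulmx1 gl_mulVmx eqxx.
Qed.
Definition gl_mul a b :=
  @MkGL (gl_mx a *m gl_mx b, gl_invmx b *m gl_invmx a) (gl_mul_subproof a b).

Lemma gl_mulA : associative gl_mul.
Proof. by move=> a b c; apply: val_inj; rewrite /= /gl_mx /gl_invmx /= !mulmxA. Qed.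
Lemma gl_mul1 : left_id gl_one gl_mul.
Proof.
by move=> [[a b] p]; apply: val_inj; rewrite /= /gl_mx /gl_invmx /= mul1mx mulmx1.
Qed.
Lemma gl_mulr1 : right_id gl_one gl_mul.
Proof.
by move=> [[a b] p]; apply: val_inj; rewrite /= /gl_mx /gl_invmx /= mul1mx mulmx1.
Qed.
Lemma gl_mulV : left_inverse gl_one gl_inv gl_mul.
Proof. by move=> a; apply: val_inj; rewrite /= gl_mulVmx. Qed.
Lemma gl_mulrV : right_inverse gl_one gl_inv gl_mul.
Proof. by move=> a; apply: val_inj; rewrite /= gl_mulmxV. Qed.

HB.instance Definition _ :=
  isGroup.Build GL gl_mulA gl_mul1 gl_mulr1 gl_mulV gl_mulrV.

(* For V = k^n (columns), R (x) V = R^n with a acting by left multiplication,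
   R (x) V^\vee is identified with R^n by the dual basis and a acts on it by
   the contragredient (a^-1)^T; tensor products act by Kronecker products. *)
Definition std_act (a : GL) : 'M[R]_n := gl_mx a.
Definition dual_act (a : GL) : 'M[R]_n := (gl_invmx a)^T.
Definition tens_act (a : GL) : 'M[R]_(n * n * n) :=
  std_act a *t dual_act a *t dual_act a.

Lemma tens_act1 : tens_act 1%g = 1%:M.
Proof.
rewrite /tens_act /std_act /dual_act /gl_mx /gl_invmx /= trmx1.
have t11 p q : (1%:M : 'M[R]_p) *t (1%:M : 'M[R]_q) = 1%:M.
  apply/matrixP=> i j; case: (mxtens_indexP i) => i0 i1.
  case: (mxtens_indexP j) => j0 j1; rewrite tensmxE !mxE -natrM mulnb.
  by rewrite (can_eq (@mxtens_indexK _ _)) xpair_eqE.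
by rewrite !t11.
Qed.

Lemma tens_actM a b : tens_act (a * b)%g = tens_act a *m tens_act b.
Proof.
rewrite /tens_act /std_act /dual_act !tensmx_mul /gl_mx /gl_invmx /=.
by rewrite -!trmx_mul.
Qed.

End GeneralLinear.

Section Maps.
Variable n : nat.

Lemma gl_map_subproof (R S : comNzRingType) (f : {rmorphism R -> S})
    (a : GL R n) :
  (map_mx f (gl_mx a) *m map_mx f (gl_invmx a) == 1%:M) &&
  (map_mx f (gl_invmx a) *m map_mx f (gl_mx a) == 1%:M).
Proof. by rewrite -!map_mxM gl_mulmxV gl_mulVmx map_mx1 eqxx. Qed.

Definition gl_map (R S : comNzRingType) (f : {rmorphism R -> S})
    (a : GL R n) : GL S n :=
  @MkGL S n (map_mx f (gl_mx a), map_mx f (gl_invmx a)) (gl_map_subproof f a).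

Lemma gl_mapM (R S : comNzRingType) (f : {rmorphism R -> S}) :
  {morph gl_map f : a b / (a * b)%g}.
Proof.
by move=> a b; apply: val_inj; rewrite /= /gl_mx /gl_invmx /= !map_mxM.
Qed.

Lemma tens_act_map (R S : comNzRingType) (f : {rmorphism R -> S}) a :
  tens_act (gl_map f a) = map_mx f (tens_act a).
Proof.
by rewrite /tens_act !map_mxT /std_act /dual_act map_trmx /gl_mx /gl_invmx.
Qed.

End Maps.

Section Stabilizer.
Variables (k : fieldType) (n : nat).
Variable t : 'cV[k]_(n * n * n).

(* The image 1 (x) t of t in R (x) (V (x) V^\vee (x) V^\vee). *)
Definition base_change (R : comAlgType k) : 'cV[R]_(n * n * n) :=
  map_mx (in_alg R) t.

Definition fixes (R : comAlgType k) : {pred GL R n} :=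
  fun a => tens_act a *m base_change R == base_change R.

Lemma fixes_group_closed R : group_closed (@fixes R).
Proof.
split=> [|a b]; rewrite !unfold_in /fixes; first by rewrite tens_act1 mul1mx.
move=> /eqP fa /eqP fb; rewrite tens_actM -mulmxA -[X in _ *m (_ *m X) == _]fb.
by rewrite [X in _ *m X]mulmxA -tens_actM mulVg tens_act1 mul1mx fa.
Qed.

Record Stab (R : comAlgType k) := MkStab {
  stab_val : GL R n;
  _ : stab_val \in @fixes R
}.
HB.instance Definition _ (R : comAlgType k) := [isSub for @stab_val R].
HB.instance Definition _ (R : comAlgType k) := [Choice of Stab R by <:].
HB.instance Definition _ (R : comAlgType k) :=
  SubChoice_isSubGroup.Build (GL R n) (@fixes R) (Stab R)
    (fixes_group_closed R).

Lemma base_change_map (R S : comAlgType k) (f : {lrmorphism R -> S}) :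
  map_mx f (base_change R) = base_change S.
Proof. by apply/matrixP=> i j; rewrite !mxE linearZ rmorph1. Qed.

Lemma stab_map_subproof (R S : comAlgType k) (f : {lrmorphism R -> S})
    (a : Stab R) :
  gl_map f (stab_val a) \in @fixes S.
Proof.
rewrite unfold_in /fixes tens_act_map -(base_change_map f) -map_mxM.
by case: a => a /= /eqP ->.
Qed.

Definition stab_map (R S : comAlgType k) (f : {lrmorphism R -> S})
  (a : Stab R) : Stab S := MkStab (stab_map_subproof f a).

Lemma stab_mapM (R S : comAlgType k) (f : {lrmorphism R -> S}) :
  {morph stab_map f : a b / (a * b)%g}.
Proof.
move=> a b; apply: val_inj => /=.
exact: (gl_mapM f (stab_val a) (stab_val b)).
Qed.

HB.instance Definition _ (R S : comAlgType k) (f : {lrmorphism R -> S}) :=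
  isMultiplicative.Build (Stab R) (Stab S) (stab_map f) (stab_mapM f).

Lemma stab_map_ext (R S : comAlgType k) (f g : {lrmorphism R -> S}) :
  f =1 g -> stab_map f =1 stab_map g.
Proof.
move=> fg a; apply: val_inj; apply: val_inj => /=.
by congr (_, _); apply/matrixP=> i j; rewrite !mxE fg.
Qed.

Lemma stab_map_id (R : comAlgType k) :
  stab_map (idfun : {lrmorphism R -> R}) =1 id.
Proof.
move=> a; apply: val_inj; apply: val_inj => /=.
by rewrite [RHS]surjective_pairing; congr (_, _); apply/matrixP=> i j; rewrite !mxE.
Qed.

Lemma stab_map_comp (R S T : comAlgType k)
    (g : {lrmorphism S -> T}) (f : {lrmorphism R -> S}) :
  stab_map (g \o f : {lrmorphism R -> T}) =1 stab_map g \o stab_map f.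
Proof.
move=> a; apply: val_inj; apply: val_inj => /=.
by congr (_, _); apply/matrixP=> i j; rewrite !mxE.
Qed.

Definition stabilizer : group_functor k :=
  @GroupFunctor k (fun R => Stab R : groupType)
    (fun R S f => stab_map f : {multiplicative Stab R -> Stab S})
    stab_map_ext stab_map_id stab_map_comp.

End Stabilizer.

(* Main.v *)
Require Import Defs.
From HB Require Import structures.
From mathcomp Require Import all_boot all_order all_algebra.
From mathcomp Require Import mxtens mpoly ring_quotient generic_quotient zify.
From Stdlib Require Import Classical ClassicalEpsilon.

(* Let A be the coordinate ring of G.  Every finite subset of A lies in a
   finite-dimensional subcoalgebra, and the ideal of relations between
   generators of A is finitely generated.  Hence there are finite-dimensional
   subspaces V, U of A, stable under translations, with 1 in V and V V in U,
   such that an algebra morphism A -> R is the same as a linear map U -> R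
   preserving 1 and the products of elements of V.  The linear automorphisms of
   U commuting with all left translations are the right translations by linear
   forms on U, so G is the group of automorphisms of the structure made of U
   and V, of the inclusion V -> U, of the product V x V -> U, of 1 in U and of
   the left translations of U.

   This structure is encoded in one bilinear product on the space
   k e + k a + k^N + V + U, where N = dim U.  The vector e is a left unit and
   right multiplication by e is a distinct nonzero scalar on each of the five
   summands.  A left unit is then unique, hence fixed by all automorphisms, and
   so are the five summands.  The relation a a = a + b_0 + 1_U forces a, the
   first basis vector b_0 of k^N and 1_U to be fixed, and a b_s = b_(s+1) forces
   the rest of k^N to be fixed; products with a and the b_s then express the
   inclusion V -> U and the left translations of U. *)

Set Implicit Arguments.
Unset Strict Implicit.
Unset Printing Implicit Defensive.

Import GRing.Theory.
Local Open Scope ring_scope.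

(** * Linear independence *)

Section LinearIndependence.
Variables (k : fieldType) (V : lmodType k).

Definition indep (J : finType) (b : J -> V) : Prop :=
  forall c : J -> k, \sum_j c j *: b j = 0 -> forall j, c j = 0.

Definition span (J : finType) (b : J -> V) (v : V) : Prop :=
  exists c : J -> k, v = \sum_j c j *: b j.

Lemma span_mem (J : finType) (b : J -> V) j : span b (b j).
Proof.
exists (fun i => (i == j)%:R).
rewrite (bigD1 j) //= eqxx scale1r big1 ?addr0 //.
by move=> i /negbTE ->; rewrite scale0r.
Qed.

Lemma span0 (J : finType) (b : J -> V) : span b 0.
Proof. by exists (fun=> 0); rewrite big1 // => i _; rewrite scale0r. Qed.

Lemma spanD (J : finType) (b : J -> V) v w :
  span b v -> span b w -> span b (v + w).
Proof.
move=> [c ->] [d ->]; exists (fun j => c j + d j).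
by rewrite -big_split; apply: eq_bigr => j _; rewrite scalerDl.
Qed.

Lemma spanZ (J : finType) (b : J -> V) a v : span b v -> span b (a *: v).
Proof.
move=> [c ->]; exists (fun j => a * c j).
by rewrite scaler_sumr; apply: eq_bigr => j _; rewrite scalerA.
Qed.

Lemma span_sum (J : finType) (b : J -> V) (I : Type) (r : seq I) (P : pred I)
    (F : I -> V) :
  (forall i, P i -> span b (F i)) -> span b (\sum_(i <- r | P i) F i).
Proof. by move=> bF; elim/big_ind: _ => //; [apply: span0 | apply: spanD]. Qed.

Lemma span_trans (J K : finType) (b : J -> V) (d : K -> V) v :
  (forall j, span d (b j)) -> span b v -> span d v.
Proof. by move=> db [c ->]; apply: span_sum => j _; apply: spanZ. Qed.

Lemma indep_inj (J : finType) (b : J -> V) (c d : J -> k) :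
  indep b -> \sum_j c j *: b j = \sum_j d j *: b j -> c =1 d.
Proof.
move=> ib /eqP; rewrite -subr_eq0 -sumrB => /eqP E j; apply/eqP.
rewrite -subr_eq0; apply/eqP; apply: (ib (fun j => c j - d j)).
by rewrite -{}[RHS]E; apply: eq_bigr => i _; rewrite scalerBl.
Qed.

Definition join_family (T : Type) (J K : Type) (b : J -> T) (d : K -> T)
  (x : J + K) : T := match x with inl j => b j | inr j => d j end.

Lemma span_joinl (J K : finType) (b : J -> V) (d : K -> V) v :
  span b v -> span (join_family b d) v.
Proof.
by apply: span_trans => j; apply: (span_mem (join_family b d) (inl j)).
Qed.

Lemma span_joinr (J K : finType) (b : J -> V) (d : K -> V) v :
  span d v -> span (join_family b d) v.
Proof.
by apply: span_trans => j; apply: (span_mem (join_family b d) (inr j)).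
Qed.

(** Excluded middle decides, for each vector of [s] in turn, whether it already lies in the span. If
    not, it is appended: a vanishing combination with a nonzero coefficient on it would put it in
    the span. *)
Lemma indep_extend (J : finType) (b : J -> V) (s : seq V) : indep b ->
  exists (K : finType) (d : K -> V),
    [/\ indep (join_family b d), forall v, v \in s -> span (join_family b d) v
      & forall i, d i \in s].
Proof.
move=> ib; elim: s => [|v s [K [d [id_ sd ds]]]].
  exists void, (fun x : void => match x with end); split=> // c.
  rewrite big_sumType /= [X in _ + X]big1 ?addr0; last by case.
  by move=> /ib c0 [j|[]]; apply: c0.
have [vd|nvd] := classic (span (join_family b d) v).
  exists K, d; split=> // [w|i]; first by rewrite inE => /predU1P[->|/sd].
  by rewrite inE ds orbT.
pose d' := join_family d (fun _ : 'I_1 => v).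
have sub w : span (join_family b d) w -> span (join_family b d') w.
  apply: span_trans => -[j|j].
    exact: (span_mem (join_family b d') (inl j)).
  exact: (span_mem (join_family b d') (inr (inl j))).
exists (K + 'I_1)%type, d'; split.
- move=> c; rewrite !big_sumType /= big_ord1 /= addrA => E.
  have cv : c (inr (inr ord0)) = 0.
    apply/eqP/negP => /negP cn0; case: nvd.
    exists (fun x => - (c (inr (inr ord0)))^-1 *
             c match x with inl j => inl j | inr j => inr (inl j) end).
    apply: (scalerI cn0); rewrite scaler_sumr big_sumType /=.
    move/eqP: E; rewrite addrC addr_eq0 => /eqP ->; rewrite opprD -!sumrN.
    by congr (_ + _); apply: eq_bigr => j _;
       rewrite !scalerA mulrA mulrN divff // mulN1r scaleNr.
  pose c' (x : J + K) :=
    c match x with inl j => inl j | inr j => inr (inl j) end.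
  have c'0 : forall x, c' x = 0.
    by apply: id_; rewrite -[RHS]E cv scale0r addr0 big_sumType.
  move=> [j|[j|j]]; [exact: (c'0 (inl j)) | exact: (c'0 (inr j)) |].
  by rewrite (ord1 j).
- move=> w; rewrite inE => /predU1P[->|/sd]; last exact: sub.
  exact: (span_mem (join_family b d') (inr (inr ord0))).
- by move=> [j|j] /=; rewrite inE ?ds ?eqxx ?orbT.
Qed.

Lemma basis_exists (s : seq V) :
  exists (K : finType) (d : K -> V),
    [/\ indep d, forall v, v \in s -> span d v & forall i, d i \in s].
Proof.
have iv : indep (fun x : void => match x with end : V) by move=> c _ [].
have [K [d [id_ sd ds]]] := indep_extend s iv.
exists K, d; split=> // [c c0|v /sd].
  pose c' (x : void + K) := if x is inr j then c j else 0.
  suff c'0 : forall x, c' x = 0 by move=> j; apply: (c'0 (inr j)).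
  by apply: id_; rewrite big_sumType /= c0 addr0 big1 // => -[].
by apply: span_trans => -[[]|j]; apply: span_mem.
Qed.

Lemma basis_of_family (J : finType) (b : J -> V) :
  exists (K : finType) (d : K -> V),
    [/\ indep d, forall j, span d (b j) & forall i, span b (d i)].
Proof.
have [K [d [id_ sd ds]]] := basis_exists [seq b j | j <- enum J].
exists K, d; split=> // [j|i]; first by apply/sd/map_f; rewrite mem_enum.
by have /mapP[j _ ->] := ds i; apply: span_mem.
Qed.

End LinearIndependence.

(** * Hilbert's basis theorem *)

Section Noetherian.

Definition ideal (R : comNzRingType) (P : R -> Prop) : Prop :=
  [/\ P 0, forall x y, P x -> P y -> P (x + y) & forall a x, P x -> P (a * x)].

(** The intersection of all ideals containing [s]. In this form membership is an induction
    principle: a property holds on the generated ideal once it defines an ideal containing [s]. *)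
Definition ideal_gen (R : comNzRingType) (s : seq R) (x : R) : Prop :=
  forall Q, ideal Q -> (forall y, y \in s -> Q y) -> Q x.

Definition noetherian (R : comNzRingType) : Prop :=
  forall P : R -> Prop, ideal P ->
  exists2 s : seq R, forall x, x \in s -> P x & forall x, P x -> ideal_gen s x.

Lemma ideal_preim (R S : comNzRingType) (f : {rmorphism R -> S})
    (P : S -> Prop) : ideal P -> ideal (fun x => P (f x)).
Proof.
move=> [P0 PD PM].
by split=> [|x y|a x]; rewrite (rmorph0, rmorphD, rmorphM); auto.
Qed.

Lemma ideal_ker (R S : comNzRingType) (f : {rmorphism R -> S}) :
  ideal (fun x => f x = 0).
Proof.
apply: (@ideal_preim _ _ f (fun y => y = 0)).
by split=> // [x y -> ->|a x ->]; rewrite ?addr0 ?mulr0.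
Qed.

Lemma ideal_genP (R : comNzRingType) (s : seq R) : ideal (ideal_gen s).
Proof.
split=> [Q [] //|x y sx sy Q iQ sQ|a x sx Q iQ sQ]; case: (iQ) => Q0 QD QM.
  by apply: QD; [apply: sx | apply: sy].
by apply: QM; apply: sx.
Qed.

Lemma ideal_gen_mem (R : comNzRingType) (s : seq R) x :
  x \in s -> ideal_gen s x.
Proof. by move=> xs Q _; apply. Qed.

Lemma ideal_gen_sub (R : comNzRingType) (s t : seq R) x :
  {subset s <= t} -> ideal_gen s x -> ideal_gen t x.
Proof. by move=> st sx Q iQ tQ; apply: sx => // y /st/tQ. Qed.

Lemma idealB (R : comNzRingType) (P : R -> Prop) x y :
  ideal P -> P x -> P y -> P (x - y).
Proof. by move=> [_ PD PM] Px Py; apply: PD; rewrite // -mulN1r; apply: PM. Qed.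

Lemma noetherian_surj (R S : comNzRingType) (f : {rmorphism R -> S}) :
  (forall y, exists x, f x = y) -> noetherian R -> noetherian S.
Proof.
move=> surjf nR P iP; have [s sP sg] := nR _ (ideal_preim f iP).
exists (map f s) => [y /mapP[x /sP Px ->] //|y].
have [x <-] := surjf y => /sg sx Q iQ sQ.
by apply: (sx (fun z => Q (f z)) (ideal_preim f iQ)) => z zs; apply/sQ/map_f.
Qed.

Lemma noetherian_field (k : fieldType) : noetherian k.
Proof.
move=> P [P0 PD PM].
have [[x xn0 Px]|nP] := classic (exists2 x, x != 0 & P x).
  exists [:: x] => [y|y Py Q [_ _ QM] sQ]; first by rewrite inE => /eqP ->.
  by rewrite -(divfK xn0 y); apply/QM/sQ; rewrite mem_head.
exists [::] => // x Px Q [Q0 _ _] _.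
by have [-> //|xn0] := eqVneq x 0; case: nP; exists x.
Qed.

(** * Leading coefficients of an ideal of polynomials *)

Section HilbertBasis.
Variables (R : comNzRingType) (nR : noetherian R).
Variables (P : {poly R} -> Prop) (iP : ideal P).

Let lead n (a : R) : Prop := exists2 p, P p & (size p <= n.+1)%N /\ p`_n = a.

Let lead_ideal n : ideal (lead n).
Proof.
case: iP => P0 PD PM.
split=> [|x y [p Pp [sp <-]] [q Pq [sq <-]]|a x [p Pp [sp <-]]].
- by exists 0; rewrite // size_poly0 coef0.
- exists (p + q); [exact: PD | split; last by rewrite coefD].
  by rewrite (leq_trans (size_polyD _ _)) // geq_max sp.
- exists (a%:P * p); [exact: PM | split; last by rewrite coefCM].
  by rewrite mul_polyC (leq_trans (size_scale_leq _ _)).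
Qed.

Let lead_mono m n a : (m <= n)%N -> lead m a -> lead n a.
Proof.
case: iP => P0 PD PM mn [p Pp [sp <-]].
exists ('X^(n - m) * p); [exact: PM | split; last first].
  by rewrite coefXnM ltnNge leq_subr /= subKn.
have [->|pn0] := eqVneq p 0; first by rewrite mulr0 size_poly0.
rewrite size_monicM ?monicXn // size_polyXn addSn /=.
by rewrite (leq_trans (leq_add (leqnn _) sp)) // addnS subnK.
Qed.

Let lift_seq n (s : seq R) : (forall a, a \in s -> lead n a) ->
  exists t : seq {poly R}, [/\ forall p, p \in t -> P p,
    forall p, p \in t -> (size p <= n.+1)%N &
    forall a, a \in s -> exists2 p, p \in t & p`_n = a].
Proof.
elim: s => [|a s IH] H; first by exists [::].
have [|t [tP ts ta]] := IH; first by move=> b bs; apply: H; rewrite inE bs orbT.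
have [p Pp [sp pa]] := H a (mem_head _ _).
exists (p :: t); split=> [q|q|b]; rewrite inE.
- by move=> /predU1P[->|/tP].
- by move=> /predU1P[->|/ts].
- move=> /predU1P[->|/ta[q qt <-]]; first by exists p; rewrite ?mem_head.
  by exists q; rewrite ?inE ?qt ?orbT.
Qed.

(** The coefficients that the ideal of [t] realises in degree [m] form an ideal, which contains [s]
    because lifts can be multiplied by ['X^(m - n)]. One finite set of lifts thus serves every
    degree from [n] on. *)
Let top_coef (n m : nat) (s : seq R) (t : seq {poly R}) (a : R) :
    (n <= m)%N -> (forall p, p \in t -> (size p <= n.+1)%N) ->
    (forall b, b \in s -> exists2 p, p \in t & p`_n = b) ->
  ideal_gen s a ->
  exists2 q, ideal_gen t q & (size q <= m.+1)%N /\ q`_m = a.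
Proof.
move=> nm ts st ag.
pose Q (b : R) := exists2 q, ideal_gen t q & (size q <= m.+1)%N /\ q`_m = b.
apply: (ag Q); last first.
  move=> b /st[p pt <-]; exists ('X^(m - n) * p).
    by have [_ _ gM] := ideal_genP t; apply: gM; apply: ideal_gen_mem.
  split; last by rewrite coefXnM ltnNge leq_subr /= subKn.
  have [->|pn0] := eqVneq p 0; first by rewrite mulr0 size_poly0.
  rewrite size_monicM ?monicXn // size_polyXn addSn /=.
  by rewrite (leq_trans (leq_add (leqnn _) (ts _ pt))) // addnS subnK.
have [g0 gD gM] := ideal_genP t.
split=> [|x y [p Pp [sp <-]] [q Pq [sq <-]]|c x [p Pp [sp <-]]].
- by exists 0; rewrite // size_poly0 coef0.
- exists (p + q); [exact: gD | split; last by rewrite coefD].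
  by rewrite (leq_trans (size_polyD _ _)) // geq_max sp.
- exists (c%:P * p); [exact: gM | split; last by rewrite coefCM].
  by rewrite mul_polyC (leq_trans (size_scale_leq _ _)).
Qed.

Let size_sub_top (p q : {poly R}) m :
  (size p <= m.+1)%N -> (size q <= m.+1)%N -> q`_m = p`_m ->
  (size (p - q)%R <= m)%N.
Proof.
move=> sp sq pq; apply/leq_sizeP => j mj; rewrite coefB.
have [<-|nj] := eqVneq m j; first by rewrite pq subrr.
have ltmj : (m < j)%N by rewrite ltn_neqAle nj.
by rewrite !nth_default ?subrr // (leq_trans _ ltmj).
Qed.

(** Induction on [n]: lifts of generators of [lead n] cancel the coefficient of degree [n], which
    leaves a polynomial of size at most [n]. *)
Let small_gen n : exists2 s : seq {poly R}, forall p, p \in s -> P p &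
  forall p, P p -> (size p <= n)%N -> ideal_gen s p.
Proof.
elim: n => [|n [s sP sg]].
  exists [::] => // p _; rewrite leqn0 size_poly_eq0 => /eqP ->.
  by have [] := ideal_genP ([::] : seq {poly R}).
have [a aL ag] := nR (lead_ideal n).
have [t [tP ts ta]] := lift_seq aL.
exists (s ++ t) => [p|p Pp sp]; first by rewrite mem_cat => /orP[/sP|/tP].
have /ag/(top_coef (leqnn n) ts ta)[q tq [sq qp]] : lead n p`_n by exists p.
have [_ gD _] := ideal_genP (s ++ t).
rewrite -(subrK q p); apply: gD.
  apply: (@ideal_gen_sub _ s); first by move=> x xs; rewrite mem_cat xs.
  apply: sg (size_sub_top sp sq qp); apply: idealB => //.
  by apply: tq.
by apply: ideal_gen_sub tq => x xt; rewrite mem_cat xt orbT.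
Qed.

(** The ideals [lead n] increase, so finitely many generators of their union all lie in one
    [lead N]. Their lifts lower the size of any element of [P] of size above [N]; [small_gen]
    handles the others. *)
Lemma hilbert_basis_poly :
  exists2 s : seq {poly R}, forall p, p \in s -> P p &
    forall p, P p -> ideal_gen s p.
Proof.
have iL : ideal (fun a => exists n, lead n a).
  split=> [|x y [m xm] [n yn]|a x [m xm]].
  - by exists 0%N; have [] := lead_ideal 0.
  - exists (maxn m n); have [_ lD _] := lead_ideal (maxn m n).
    by apply: lD; [apply: lead_mono xm | apply: lead_mono yn]; lia.
  - by exists m; have [_ _ lM] := lead_ideal m; apply: lM.
have [a aL ag] := nR iL.
have [N aN] : exists N, forall x, x \in a -> lead N x.
  elim: {ag} a aL => [|x a IH] aL; first by exists 0%N.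
  have [|N aN] := IH; first by move=> y ya; apply: aL; rewrite inE ya orbT.
  have [n xn] := aL x (mem_head _ _); exists (maxn n N) => y.
  rewrite inE => /predU1P[->|/aN yN]; first by apply: lead_mono xn; lia.
  by apply: lead_mono yN; lia.
have [t [tP ts ta]] := lift_seq aN.
have [s sP sg] := small_gen N.
exists (s ++ t) => [p|p]; first by rewrite mem_cat => /orP[/sP|/tP].
have [n] := ubnP (size p); elim: n p => // n IH p sp Pp.
have [spN|Nsp] := leqP (size p) N.
  by apply: (ideal_gen_sub (s := s)) (sg _ Pp spN) => x xs; rewrite mem_cat xs.
have sp1 : size p = (size p).-1.+1 by lia.
have /ag H : exists n, lead n p`_((size p).-1).
  by exists (size p).-1, p; rewrite // -sp1.
have Nm : (N <= (size p).-1)%N by lia.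
have [q tq [sq qp]] := top_coef Nm ts ta H.
have [_ gD _] := ideal_genP (s ++ t).
rewrite -(subrK q p); apply: gD; last first.
  by apply: ideal_gen_sub tq => x xt; rewrite mem_cat xt orbT.
apply: IH; last by apply: idealB => //; apply: tq.
apply: leq_ltn_trans (size_sub_top _ sq qp) _; first by rewrite -sp1.
by rewrite -ltnS -sp1.
Qed.

End HilbertBasis.

Lemma noetherian_poly (R : comNzRingType) : noetherian R -> noetherian {poly R}.
Proof. by move=> nR P; apply: hilbert_basis_poly. Qed.

(** Evaluation at the last variable maps the polynomials in one variable over [{mpoly k[m]}] onto
    [{mpoly k[m.+1]}]; surjectivity is enough. *)
Lemma noetherian_mpoly (k : fieldType) m : noetherian {mpoly k[m]}.
Proof.
elim: m => [|m IH].
  apply: (noetherian_surj (f := @mpolyC 0 k)); last exact: noetherian_field.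
  move=> p; exists p@_0%MM; apply/mpolyP => u; rewrite mcoeffC.
  suff -> : u = 0%MM by rewrite eqxx mulr1.
  by apply/mnmP => -[].
have cX : commr_rmorph (@mwiden m k) 'X_ord_max by move=> p; apply: mulrC.
pose f : {rmorphism {poly {mpoly k[m]}} -> {mpoly k[m.+1]}} := horner_morph cX.
apply: (noetherian_surj (f := f)); last exact: noetherian_poly.
move=> p; elim/mpolyind: p => [|c u p _ _ [q <-]].
  by exists 0; rewrite rmorph0.
suff [r fr] : exists r, f r = 'X_[u].
  exists ((c%:MP_[m])%:P * r + q).
  by rewrite rmorphD rmorphM /= fr horner_morphC /= mwidenC mul_mpolyC.
rewrite mpolyXE_id; elim/big_ind: _ => [|_ _ [x <-] [y <-]|i _].
- by exists 1; rewrite rmorph1.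
- by exists (x * y); rewrite rmorphM.
suff [r fr] : exists r, f r = 'X_i by exists (r ^+ u i); rewrite rmorphXn fr.
case: (unliftP ord_max i) => [j ->|->]; last by exists 'X; apply: horner_morphX.
exists (('X_j)%:P); rewrite /f /= horner_morphC /= mwidenX mnmwiden1.
by congr 'X_[U_(_)]; apply: val_inj; rewrite /= /bump leqNgt ltn_ord.
Qed.

End Noetherian.

(** * Quotients and tensor products of algebras *)

Section RestrictedScalars.
Variables (k : fieldType) (B : comNzRingType) (j : {rmorphism k -> B}).

(** The morphism is a phantom argument, so that the same ring can carry one algebra structure for
    each [j]. *)
Definition alg_along of {rmorphism k -> B} : Type := B.

HB.instance Definition _ := GRing.ComNzRing.on (alg_along j).

Let scale (c : k) (x : alg_along j) : alg_along j := j c * x.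

Fact alg_along_scalerA a b v : scale a (scale b v) = scale (a * b) v.
Proof. by rewrite /scale rmorphM mulrA. Qed.
Fact alg_along_scale1r : left_id 1 scale.
Proof. by move=> v; rewrite /scale rmorph1 mul1r. Qed.
Fact alg_along_scalerDr : right_distributive scale +%R.
Proof. by move=> a u v; rewrite /scale mulrDr. Qed.
Fact alg_along_scalerDl v : {morph scale^~ v : a b / a + b}.
Proof. by move=> a b; rewrite /scale rmorphD mulrDl. Qed.

HB.instance Definition _ := GRing.Zmodule_isLmodule.Build k (alg_along j)
  alg_along_scalerA alg_along_scale1r alg_along_scalerDr alg_along_scalerDl.

Fact alg_along_scalerAl (a : k) (u v : alg_along j) :
  a *: (u * v) = (a *: u) * v.
Proof. by rewrite /GRing.scale /= /scale mulrA. Qed.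

HB.instance Definition _ := GRing.Lmodule_isLalgebra.Build k (alg_along j)
  alg_along_scalerAl.
HB.instance Definition _ := GRing.Lalgebra_isComAlgebra.Build k (alg_along j).

Lemma alg_along_in_alg c : c%:A = j c :> alg_along j.
Proof. exact: mulr1. Qed.

End RestrictedScalars.

(** Informative excluded middle turns [P] into the boolean predicate on which ring quotients are
    built. Since 1 is outside [P], the quotient is nonzero. *)
Lemma quotient_alg (k : fieldType) (B : comNzRingType) (j : {rmorphism k -> B})
    (P : B -> Prop) : ideal P -> ~ P 1 ->
  exists (Q : comAlgType k) (pi : {rmorphism B -> Q}),
    [/\ forall q, exists b, pi b = q, forall b, pi b = 0 <-> P b
      & forall c, pi (j c) = c%:A].
Proof.
move=> [P0 PD PM] P1.
pose S : {pred B} :=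
  fun b => if excluded_middle_informative (P b) then true else false.
have SP b : reflect (P b) (b \in S).
  by rewrite unfold_in /S; case: excluded_middle_informative => ?; constructor.
have iS : idealr_closed S.
  split=> [||a u v /SP Pu /SP Pv]; [exact/SP | exact/SP |].
  by apply/SP/PD => //; apply: PM.
pose I : idealr B := HB.pack S (isIdealr.Build B S iS).
pose pi0 : {rmorphism B -> {ideal_quot I}} := \pi_{ideal_quot I}%qT.
pose Q : comAlgType k := alg_along (pi0 \o j).
exists Q, pi0; split=> [q|b|c].
- by exists (repr (q : {ideal_quot I})); apply: reprK.
- split=> [H|/SP bS]; last first.
    by apply/eqP; rewrite -[0](rmorph0 pi0) -Quotient.idealrBE subr0.
  apply/SP; have := Quotient.idealrBE I b 0; rewrite subr0 => ->.
  by apply/eqP; rewrite -/pi0 H rmorph0.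
- by rewrite (alg_along_in_alg (pi0 \o j)).
Qed.

Lemma alg_descent (k : fieldType) (B : comNzRingType) (Q R : comAlgType k)
    (pi : {rmorphism B -> Q}) (f : {rmorphism B -> R}) :
    (forall q, exists b, pi b = q) ->
    (forall b, pi b = 0 -> f b = 0) ->
    (forall c, exists2 b, pi b = c%:A & f b = c%:A) ->
  exists h : {lrmorphism Q -> R}, forall b, h (pi b) = f b.
Proof.
move=> surj ker sc.
pose sec q := sval (constructive_indefinite_description _ (surj q)).
have secK q : pi (sec q) = q.
  by rewrite /sec; case: constructive_indefinite_description.
have eqf b c : pi b = pi c -> f b = f c.
  move=> bc; apply/eqP; rewrite -subr_eq0 -rmorphB; apply/eqP/ker.
  by rewrite rmorphB bc subrr.
pose h q := f (sec q).
have hpi b : h (pi b) = f b by apply: eqf.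
have hB : zmod_morphism h.
  by move=> x y; rewrite -(secK x) -(secK y) -rmorphB !hpi rmorphB.
have hM : monoid_morphism h.
  split=> [|x y]; first by rewrite -(rmorph1 pi) hpi rmorph1.
  by rewrite -(secK x) -(secK y) -rmorphM !hpi rmorphM.
have hZ : scalable_for *:%R h.
  move=> c x; have [b pb fb] := sc c.
  by rewrite -mulr_algl -pb -(secK x) -rmorphM !hpi rmorphM fb mulr_algl.
pose H : {lrmorphism Q -> R} := HB.pack h
  (GRing.isZmodMorphism.Build _ _ h hB) (GRing.isMonoidMorphism.Build _ _ h hM)
  (GRing.isScalable.Build _ _ _ _ h hZ).
by exists H.
Qed.

Section Presentation.
Variables (k : fieldType) (A : comAlgType k) (m : nat) (h : 'I_m -> A).

Definition peval : {rmorphism {mpoly k[m]} -> A} := mmap (in_alg A) h.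

Lemma pevalC c : peval c%:MP = c%:A.
Proof. exact: mmapC. Qed.

Lemma pevalX i : peval 'X_i = h i.
Proof. by rewrite /peval /= mmapX mmap1U. Qed.

Lemma pevalZ c p : peval (c *: p) = c *: peval p.
Proof. by rewrite /peval /= mmapZ mulr_algl. Qed.

End Presentation.

Lemma lrmorph_peval (k : fieldType) (A R : comAlgType k) (m : nat)
    (h : 'I_m -> A) (f : {lrmorphism A -> R}) p :
  f (peval h p) = peval (fun i => f (h i)) p.
Proof.
elim/mpolyind: p => [|c u p _ _ IH]; first by rewrite !rmorph0.
rewrite !rmorphD /= {}IH !pevalZ linearZ /=; congr (_ *: _ + _).
rewrite mpolyXE_id !rmorph_prod; apply: eq_bigr => i _.
by rewrite !rmorphXn /= !pevalX.
Qed.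

Lemma peval_ext (k : fieldType) (A : comAlgType k) (m : nat)
  (h h' : 'I_m -> A) : h =1 h' -> peval h =1 peval h'.
Proof.
move=> hh' p; elim/mpolyind: p => [|c u p _ _ IH]; first by rewrite !rmorph0.
rewrite !rmorphD /= {}IH !pevalZ; congr (_ *: _ + _).
rewrite mpolyXE_id !rmorph_prod; apply: eq_bigr => i _.
by rewrite !rmorphXn /= !pevalX hh'.
Qed.

Lemma choose_fun (T U : Type) (P : T -> U -> Prop) :
  (forall x, exists y, P x y) -> exists f, forall x, P x (f x).
Proof.
move=> H; exists (fun x => sval (constructive_indefinite_description _ (H x))).
by move=> x; case: constructive_indefinite_description.
Qed.

(** * The tensor product of [A] and [R], as a quotient of [{mpoly R[m]}] *)

Section TensorProduct.
Variables (k : fieldType) (A R : comAlgType k) (m : nat) (h : 'I_m -> A).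
Hypothesis h_surj : forall a, exists p, peval h p = a.

Let inc : {rmorphism {mpoly k[m]} -> {mpoly R[m]}} := map_mpoly (in_alg R).

(* The extension to R of the ideal of relations between the generators h. *)
Let rel (p : {mpoly R[m]}) : Prop := exists2 s : seq (R * {mpoly k[m]}),
  forall x, x \in s -> peval h x.2 = 0 & p = \sum_(x <- s) x.1 *: inc x.2.

Let rel_ideal : ideal rel.
Proof.
split=> [|p q [s sP ->] [t tP ->]|a p [s sP ->]].
- by exists [::]; rewrite // big_nil.
- exists (s ++ t); last by rewrite big_cat.
  by move=> x; rewrite mem_cat => /orP[/sP|/tP].
have relD p1 p2 : rel p1 -> rel p2 -> rel (p1 + p2).
  move=> [s1 s1P ->] [s2 s2P ->]; exists (s1 ++ s2); last by rewrite big_cat.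
  by move=> x; rewrite mem_cat => /orP[/s1P|/s2P].
elim/mpolyind: a => [|c u a _ _ IH].
  by rewrite mul0r; exists [::]; rewrite // big_nil.
rewrite mulrDl; apply: relD => //.
exists [seq (c * x.1, 'X_[u] * x.2) | x <- s].
  by move=> _ /mapP[x /sP x0 ->] /=; rewrite rmorphM /= x0 mulr0.
rewrite big_map mulr_sumr; apply: eq_bigr => x _ /=.
rewrite /inc /= rmorphM /= map_mpolyX -scalerA -scalerAl; congr (_ *: _).
by rewrite -!scalerAr.
Qed.

(** Expand the [r j] and the coefficients occurring in the relation in a [k]-basis [e] of their
    span. Each coordinate of the identity is then an identity of polynomials over [k]; evaluated in
    [A], its right side vanishes, and independence kills the coordinates of the [r j]. *)
Let rel_disjoint (J : finType) (b : J -> {mpoly k[m]}) (r : J -> R) :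
    indep (fun j => peval h (b j)) -> rel (\sum_j r j *: inc (b j)) ->
  forall j, r j = 0.
Proof.
move=> ib [s sP E].
have [K [e [ie se _]]] :=
  basis_exists ([seq r j | j <- enum J] ++ [seq x.1 | x <- s]).
have /choose_fun[rho rhoP] : forall j, span e (r j).
  move=> j; apply: se.
  by rewrite mem_cat (map_f r) // mem_enum.
have /choose_fun[gam gamP] : forall i, span e (tnth (in_tuple s) i).1.
  move=> i; apply: se.
  by rewrite mem_cat (map_f fst) ?orbT // (mem_tnth i (in_tuple s)).
have H l : \sum_j rho j l *: b j =
    \sum_i gam i l *: (tnth (in_tuple s) i).2.
  apply/mpolyP => u; apply/eqP; rewrite -subr_eq0; apply/eqP.
  pose c l := (\sum_j rho j l *: b j)@_u -
    (\sum_i gam i l *: (tnth (in_tuple s) i).2)@_u.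
  apply: (ie c); rewrite {l}/c.
  move/(congr1 (mcoeff u))/eqP: E; rewrite -subr_eq0 => /eqP E.
  rewrite -[RHS]E.
  under eq_bigr => l _ do rewrite scalerBl; rewrite sumrB; congr (_ - _).
    rewrite !raddf_sum /=.
    under [RHS]eq_bigr => j _ do
      rewrite mcoeffZ mcoeff_map_mpoly /= mulr_algr rhoP scaler_sumr.
    rewrite exchange_big /=; apply: eq_bigr => l _.
    rewrite raddf_sum /= scaler_suml; apply: eq_bigr => j _.
    by rewrite mcoeffZ scalerA mulrC.
  rewrite [in RHS]big_tnth !raddf_sum /=.
  under [RHS]eq_bigr => j _ do
    rewrite mcoeffZ mcoeff_map_mpoly /= mulr_algr gamP scaler_sumr.
  rewrite exchange_big /=; apply: eq_bigr => l _.
  rewrite raddf_sum /= scaler_suml; apply: eq_bigr => j _.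
  by rewrite mcoeffZ scalerA mulrC.
move=> j; rewrite rhoP big1 // => l _.
suff -> : rho j l = 0 by rewrite scale0r.
apply: (ib (fun j => rho j l)).
move/(congr1 (peval h)): (H l); rewrite !rmorph_sum.
rewrite [RHS]big1 => [E'|i _] /=.
  by rewrite -[RHS]E'; apply: eq_bigr => i _; rewrite -pevalZ.
by rewrite [LHS]pevalZ sP ?scaler0 // mem_tnth.
Qed.

(** The three facts used about the tensor product: finite sums of pure tensors exhaust it, pairs of
    morphisms factor through it, and a family independent over [k] in [A] stays independent over
    [R]. *)
Lemma tensor_alg :
  exists (S : comAlgType k) (x : {lrmorphism A -> S}) (f : {lrmorphism R -> S}),
  [/\ forall s, exists (J : finType) (b : J -> A) (r : J -> R),
        s = \sum_j x (b j) * f (r j),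
      forall (S' : comAlgType k)
          (x' : {lrmorphism A -> S'}) (f' : {lrmorphism R -> S'}),
        exists2 g : {lrmorphism S -> S'},
          (forall a, g (x a) = x' a) & forall r, g (f r) = f' r
    & forall (J : finType) (b : J -> A) (r : J -> R),
        indep b -> \sum_j x (b j) * f (r j) = 0 -> forall j, r j = 0].
Proof.
(* The quotient is nonzero: [rel_disjoint], applied to the single polynomial 1, whose value in [A]
   is nonzero, would give 1 = 0 in [R]. *)
have nrel1 : ~ rel 1.
  move=> R1; suff /(_ ord0)/eqP : forall i : 'I_1, (1 : R) = 0.
    by rewrite oner_eq0.
  apply: (@rel_disjoint _ (fun=> 1)); last first.
    by rewrite big_ord1 /= rmorph1 scale1r.
  move=> c; rewrite big_ord1 rmorph1 => /eqP; rewrite scaler_eq0 oner_eq0 orbF.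
  by move=> /eqP c0 i; rewrite (ord1 i).
have [S [pi [pi_surj pi_ker piC]]] :=
  quotient_alg (@mpolyC m R \o in_alg R) rel_ideal nrel1.
have incC c : inc c%:MP = (c%:A)%:MP by rewrite /inc /= map_mpolyC.
have [x xP] : exists x : {lrmorphism A -> S},
    forall p, x (peval h p) = pi (inc p).
  apply: (alg_descent (pi := peval h) (f := pi \o inc)) => // [p p0|c].
    apply/pi_ker; exists [:: (1, p)]; last by rewrite big_seq1 scale1r.
    by move=> y; rewrite inE => /eqP ->.
  by exists c%:MP; rewrite ?pevalC //= incC -piC.
pose f0 : {rmorphism R -> S} := pi \o @mpolyC m R.
have f0Z : scalable_for *:%R f0.
  move=> c r; rewrite -mulr_algl rmorphM /=.
  by rewrite -[RHS]mulr_algl -piC.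
pose f : {lrmorphism R -> S} := HB.pack (f0 : R -> S)
  (GRing.RMorphism.on (f0 : R -> S)) (GRing.isScalable.Build _ _ _ _ _ f0Z).
have fE r : f r = pi r%:MP by [].
exists S, x, f; split.
- move=> s; have [p <-] := pi_surj s.
  exists 'I_(size (msupp p)),
    (fun i => peval h 'X_[tnth (in_tuple (msupp p)) i]),
    (fun i => p@_(tnth (in_tuple (msupp p)) i)).
  rewrite {1}[p]mpolyE big_tnth rmorph_sum; apply: eq_bigr => i _.
  by rewrite xP fE /inc /= map_mpolyX -mul_mpolyC rmorphM mulrC.
- move=> S' x' f'; pose F : {rmorphism {mpoly R[m]} -> S'} :=
    mmap f' (fun i => x' (h i)).
  have Finc p : F (inc p) = x' (peval h p).
    rewrite lrmorph_peval; elim/mpolyind: p => [|c u p _ _ IH].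
      by rewrite !rmorph0.
    rewrite !rmorphD /= {}IH pevalZ; congr (_ + _).
    rewrite map_mpolyZ /= mmapZ.
    rewrite -[RHS]mulr_algl; congr (_ * _); first exact: rmorph_alg.
    by rewrite map_mpolyX /peval /= !mmapX.
  have FC r : F r%:MP = f' r by exact: mmapC.
  have [g gP] : exists g : {lrmorphism S -> S'}, forall p, g (pi p) = F p.
    apply: alg_descent => // [p /pi_ker[s sP ->]|c].
      rewrite rmorph_sum big_seq big1 // => y ys.
      by rewrite -mul_mpolyC rmorphM /= Finc sP // rmorph0 mulr0.
    by exists (c%:A)%:MP; rewrite -?piC // FC linearZ rmorph1.
  exists g => [a|r]; last by rewrite fE gP FC.
  by have [p <-] := h_surj a; rewrite xP gP Finc.
- move=> J b r; have [p pP] := choose_fun (fun j => h_surj (b j)).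
  move=> ib E; apply: (@rel_disjoint _ p).
    move=> c c0; apply: ib; rewrite -[RHS]c0.
    by apply: eq_bigr => j _; rewrite pP.
  apply/pi_ker; rewrite rmorph_sum -[RHS]E; apply: eq_bigr => j _.
  by rewrite -pP xP fE -mul_mpolyC rmorphM mulrC.
Qed.

End TensorProduct.

(** * The stabilizer of a product *)

Section StructureConstants.
Variables (k : fieldType) (I : finType) (T : I -> I -> I -> k).

(* The tensor of the product on k^I for which [T i j l] is the coefficient of
   the basis vector [i] in the product of the basis vectors [j] and [l]. *)
Definition structure_tensor : 'cV[k]_(#|I| * #|I| * #|I|) :=
  \col_p let z := mxtens_unindex p in let y := mxtens_unindex z.1 in
    T (enum_val y.1) (enum_val y.2) (enum_val z.2).

Variables (R : comAlgType k).

(** The coefficient of the basis vector [i] in g(e_j e_l) = g(e_j) g(e_l), where the columns of [g]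
    are the images of the basis vectors. *)
Definition multiplicative_matrix (g : I -> I -> R) : Prop := forall i j l,
  \sum_p g i p * (T p j l)%:A = \sum_q \sum_s (T i q s)%:A * g q j * g s l.

Let slice (i : 'I_#|I|) : 'M[R]_#|I| :=
  \matrix_(j, l) (T (enum_val i) (enum_val j) (enum_val l))%:A.

(** For a fixed first index the tensor is a bilinear form, on which the two dual factors act by
    congruence with the inverse matrix; the first factor mixes these forms. *)
Let fixes_slice (a : GL R #|I|) : a \in fixes structure_tensor (R := R) <->
  forall i, \sum_p gl_mx a i p *: ((gl_invmx a)^T *m slice p *m gl_invmx a) =
            slice i.
Proof.
have stE p q s : structure_tensor (mxtens_index (mxtens_index (p, q), s)) ord0 =
    T (enum_val p) (enum_val q) (enum_val s).
  by rewrite mxE mxtens_indexK; cbn [fst snd]; rewrite mxtens_indexK.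
have bcE i j l : (base_change structure_tensor R)
    (mxtens_index (mxtens_index (i, j), l)) ord0 = slice i j l.
  by rewrite /base_change mxE stE mxE.
have sum2 m1 m2 (F : 'I_(m1 * m2) -> R) :
    \sum_z F z = \sum_y \sum_s F (mxtens_index (y, s)).
  rewrite pair_bigA (reindex (@mxtens_index m1 m2)) /=.
    by apply: eq_bigr => -[].
  by exists (@mxtens_unindex _ _) => z _;
    rewrite ?mxtens_indexK ?mxtens_unindexK.
have sumE (F : 'I_(#|I| * #|I| * #|I|) -> R) : \sum_z F z =
    \sum_p \sum_s \sum_q F (mxtens_index (mxtens_index (p, q), s)).
  by rewrite !sum2; apply: eq_bigr => p _; rewrite exchange_big.
have entry i j l : (tens_act a *m base_change structure_tensor R)
      (mxtens_index (mxtens_index (i, j), l)) ord0 =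
    (\sum_p gl_mx a i p *: ((gl_invmx a)^T *m slice p *m gl_invmx a)) j l.
  rewrite mxE sumE summxE; apply: eq_bigr => p _.
  rewrite !mxE mulr_sumr; apply: eq_bigr => s _.
  rewrite !mxE mulr_suml mulr_sumr; apply: eq_bigr => q _.
  rewrite /tens_act !tensmxE /std_act /dual_act bcE.
  by rewrite !mxE -!mulrA; congr (_ * (_ * _)); rewrite mulrC.
rewrite unfold_in /fixes; split=> [/eqP E i|E].
  by apply/matrixP => j l; rewrite -entry E bcE.
apply/eqP/matrixP => z o; rewrite (ord1 o).
rewrite -(mxtens_unindexK z); case: (mxtens_unindex z) => y l.
rewrite -(mxtens_unindexK y); case: (mxtens_unindex y) => i j.
by rewrite entry E bcE.
Qed.

(** Congruence by [gl_mx a] clears the inverse matrices from the invariance of the slices and leaves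
    compatibility with the product. *)
Lemma fixes_structure_tensor (a : GL R #|I|) :
  a \in fixes structure_tensor (R := R) <->
  multiplicative_matrix (fun i j => gl_mx a (enum_rank i) (enum_rank j)).
Proof.
have sumE (F : 'I_#|I| -> R) : \sum_i F i = \sum_(i : I) F (enum_rank i).
  rewrite (reindex (@enum_rank I)) //.
  by exists enum_val => i _; rewrite ?enum_rankK ?enum_valK.
have entryl i j l : (\sum_p gl_mx a (enum_rank i) p *: slice p)
      (enum_rank j) (enum_rank l) =
    \sum_p gl_mx a (enum_rank i) (enum_rank p) * (T p j l)%:A.
  by rewrite summxE sumE; apply: eq_bigr => p _; rewrite !mxE !enum_rankK.
have entryr i j l : ((gl_mx a)^T *m slice (enum_rank i) *m gl_mx a)
      (enum_rank j) (enum_rank l) =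
    \sum_q \sum_s (T i q s)%:A * gl_mx a (enum_rank q) (enum_rank j) *
      gl_mx a (enum_rank s) (enum_rank l).
  rewrite exchange_big mxE sumE; apply: eq_bigr => s _.
  rewrite mxE mulr_suml sumE; apply: eq_bigr => q _.
  by rewrite !mxE !enum_rankK; congr (_ * _); rewrite mulrC.
rewrite fixes_slice; split=> [H i j l|H i].
  rewrite -entryl -entryr; move: (H (enum_rank i)) => <-.
  congr fun_of_matrix; rewrite mulmx_sumr mulmx_suml; apply: eq_bigr => p _.
  rewrite -scalemxAr -scalemxAl !mulmxA -trmx_mul gl_mulVmx.
  by rewrite trmx1 mul1mx -mulmxA gl_mulVmx mulmx1.
have {}H : \sum_p gl_mx a i p *: slice p = (gl_mx a)^T *m slice i *m gl_mx a.
  apply/matrixP => j l; rewrite -(enum_valK i) -(enum_valK j) -(enum_valK l).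
  by rewrite entryl entryr; apply: H.
transitivity ((gl_invmx a)^T *m (\sum_p gl_mx a i p *: slice p) *m gl_invmx a).
  rewrite mulmx_sumr mulmx_suml; apply: eq_bigr => p _.
  by rewrite -scalemxAr -scalemxAl.
rewrite H !mulmxA -trmx_mul gl_mulmxV trmx1 mul1mx.
by rewrite -mulmxA gl_mulmxV mulmx1.
Qed.

End StructureConstants.

(** * Encoding a structure with several sorts in one product *)

Section SortedAlgebra.
Variables (k : fieldType) (U V : finType).
Variables (D : U -> U -> U -> k) (iota : V -> U -> k).
Variables (mu : V -> V -> U -> k) (w : U -> k).
Variable la : nat -> k.
Hypothesis la0 : la 0 = 1.
Hypothesis la_inj : forall i j, (i < 5)%N -> (j < 5)%N -> la i = la j -> i = j.
Hypothesis la_neq0 : forall i, (i < 5)%N -> la i != 0.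

Definition basis_index : finType :=
  ('I_1 + ('I_1 + ('I_#|U| + (V + U))))%type.

Local Notation I := basis_index.
Local Notation inE := (inl ord0 : I).
Local Notation inA := (inr (inl ord0) : I).
Local Notation inB s := (inr (inr (inl s)) : I).
Local Notation inV v := (inr (inr (inr (inl v))) : I).
Local Notation inU p := (inr (inr (inr (inr p))) : I).

Definition sort_index (i : I) : nat :=
  match i with
  | inl _ => 0
  | inr (inl _) => 1
  | inr (inr (inl _)) => 2
  | inr (inr (inr (inl _))) => 3
  | inr (inr (inr (inr _))) => 4
  end.

(** The chain of products by a stops at the last b_s, which a sends to 0. When [D] is the
    comultiplication of U, b_s applies the [s]-th coordinate form to its left factor; these
    operators express the left translations. *)
Definition sort_product (j l i : I) : k :=
  match j, l, i with
  | inr (inl _), inr (inl _), inr (inl _) => 1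
  | inr (inl _), inr (inl _), inr (inr (inl s)) => (val s == 0)%:R
  | inr (inl _), inr (inl _), inr (inr (inr (inr p))) => w p
  | inr (inl _), inr (inr (inl s)), inr (inr (inl s')) => (val s' == s.+1)%:R
  | inr (inl _), inr (inr (inr (inl v))), inr (inr (inr (inr p))) => iota v p
  | inr (inr (inl s)), inr (inr (inr (inr p))), inr (inr (inr (inr q))) =>
      D p (enum_val s) q
  | inr (inr (inr (inl v))), inr (inr (inr (inl v'))), inr (inr (inr (inr p))) =>
      mu v v' p
  | _, _, _ => 0
  end.

(** The rule for a left factor e and the rule for a right factor e agree on e e because
    [la 0 = 1]. *)
Definition sorted_structure (i j l : I) : k :=
  if j == inE then (i == l)%:R
  else if l == inE then la (sort_index j) * (i == j)%:R
  else sort_product j l i.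

Lemma big_basis_index (R : comNzRingType) (F : I -> R) :
  \sum_i F i = F inE + (F inA + (\sum_s F (inB s) +
    (\sum_v F (inV v) + \sum_p F (inU p)))).
Proof. by rewrite !big_sumType /= !big_ord1. Qed.

Section Automorphisms.
Variable R : comAlgType k.
Local Notation t i j l := ((sorted_structure i j l)%:A : R).

Definition block_matrix (g' : V -> V -> R) (g : U -> U -> R) (i j : I) : R :=
  match i, j with
  | inl _, inl _ => 1
  | inr (inl _), inr (inl _) => 1
  | inr (inr (inl s)), inr (inr (inl s')) => (s == s')%:R
  | inr (inr (inr (inl v))), inr (inr (inr (inl v'))) => g' v v'
  | inr (inr (inr (inr p))), inr (inr (inr (inr p'))) => g p p'
  | _, _ => 0
  end.

(** In order: [g] fixes the unit [w], intertwines the inclusion [iota], commutes with the operators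
    given by [D], and is compatible with the product [mu]. *)
Definition block_morphism (g' : V -> V -> R) (g : U -> U -> R) : Prop :=
  [/\ forall p, \sum_q g p q * (w q)%:A = (w p)%:A,
      forall p v, \sum_q g p q * (iota v q)%:A =
        \sum_v' (iota v' p)%:A * g' v' v,
      forall p s j, \sum_q g p q * (D j s q)%:A =
        \sum_u (D u s p)%:A * g u j
    & forall p v1 v2, \sum_q g p q * (mu v1 v2 q)%:A =
        \sum_v1' \sum_v2' (mu v1' v2' p)%:A * g' v1' v1 * g' v2' v2].

Lemma delta_suml (J : finType) (F : J -> R) (c : J -> R) j :
  (forall q, c q = (q == j)%:R) -> \sum_q F q * c q = F j.
Proof.
move=> cj; rewrite (bigD1 j) //= cj eqxx mulr1 big1 ?addr0 // => q /negbTE qj.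
by rewrite cj qj mulr0.
Qed.

Lemma natr_alg (b : bool) : ((b%:R : k)%:A : R) = b%:R.
Proof. by rewrite scaler_nat. Qed.

Lemma sorted_structure_EE i l : t i inE l = (i == l)%:R.
Proof. by rewrite /sorted_structure eqxx natr_alg. Qed.

Lemma sorted_structure_E i j : t i j inE = (la (sort_index j))%:A * (i == j)%:R.
Proof.
rewrite /sorted_structure eqxx; case: eqP => [->|_].
  by rewrite la0 scale1r mul1r natr_alg.
by rewrite -natr_alg -scalerAl mul1r scalerA.
Qed.

Lemma sorted_structure_NE i j l : j != inE -> l != inE ->
  t i j l = (sort_product j l i)%:A.
Proof. by rewrite /sorted_structure => /negbTE -> /negbTE ->. Qed.

Let la_unit i (x : R) : (la (sort_index i))%:A * x = 0 -> x = 0.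
Proof.
rewrite -scalerAl mul1r => E; have l0 : la (sort_index i) != 0.
  by apply: la_neq0; case: i E => [?|[?|[?|[?|?]]]].
by rewrite -(scale1r x) -(mulVf l0) -scalerA E scaler0.
Qed.

Let sum_Er (F : I -> R) i :
  \sum_q t i q inE * F q = (la (sort_index i))%:A * F i.
Proof.
rewrite (bigD1 i) //= sorted_structure_E eqxx mulr1 big1 ?addr0 // => q.
by rewrite sorted_structure_E eq_sym => /negbTE ->; rewrite mulr0 mul0r.
Qed.

Let sum_El (F : I -> R) j :
  \sum_p F p * t p j inE = (la (sort_index j))%:A * F j.
Proof.
rewrite (bigD1 j) //= sorted_structure_E eqxx mulr1 big1 ?addr0 1?mulrC // => q.
by rewrite sorted_structure_E => /negbTE ->; rewrite !mulr0.
Qed.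

(** * Automorphisms of the product are block matrices *)

Section FromAutomorphism.
Variables (g gi : I -> I -> R).
Hypothesis g_inv : forall i j, \sum_q g i q * gi q j = (i == j)%:R.
Hypothesis gi_inv : forall i j, \sum_q gi i q * g q j = (i == j)%:R.
Hypothesis g_mul : multiplicative_matrix sorted_structure g.

(** As [g] is invertible, g(e) is again a left unit; [c] is the matrix of left multiplication by it.
    Hence g(e) e = e, whereas right multiplication by e only scales the coordinates of g(e) by
    nonzero factors. *)
Let col_e i : g i inE = (i == inE)%:R.
Proof.
pose c i s := \sum_q t i q s * g q inE.
have cg l : \sum_s c i s * g s l = g i l.
  transitivity (\sum_p g i p * t p inE l).
    rewrite g_mul exchange_big; apply: eq_bigr => s _.
    by rewrite mulr_suml.
  apply: delta_suml => p; exact: sorted_structure_EE.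
have c1 s : c i s = (i == s)%:R.
  rewrite -g_inv; under eq_bigr => q _ do rewrite -cg mulr_suml.
  rewrite exchange_big /=; under eq_bigr => l _.
    rewrite (eq_bigr (fun q => c i l * (g l q * gi q s))); last first.
      by move=> q _; rewrite mulrA.
    rewrite -mulr_sumr g_inv.
    over.
  by rewrite (delta_suml _ (j := s)).
have := c1 inE; rewrite /c.
rewrite sum_Er => E.
have [iE|ni] := eqVneq i inE; last first.
  by rewrite (negbTE ni) in E; apply: la_unit E.
by move: E; rewrite iE eqxx la0 scale1r mul1r.
Qed.

(** Since e is fixed, [g] commutes with right multiplication by e, hence preserves its eigenspaces,
    which are the five summands. *)
Let g_block i j : sort_index i != sort_index j -> g i j = 0.
Proof.
move=> ij; have := g_mul i j inE; rewrite sum_El exchange_big /=.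
under [RHS]eq_bigr => s _ do rewrite -mulr_suml.
rewrite (delta_suml _ col_e) sum_Er => /eqP.
rewrite -subr_eq0 -mulrBl -scalerBl => /eqP E.
have l0 : la (sort_index j) - la (sort_index i) != 0.
  rewrite subr_eq0; apply: contra ij => /eqP/la_inj ->;
  by [case: i {E} => [?|[?|[?|[?|?]]]] | case: j {E} => [?|[?|[?|[?|?]]]]].
move: E; rewrite -scalerAl mul1r => E.
by rewrite -(scale1r (g i j)) -(mulVf l0) -scalerA E scaler0.
Qed.

(* The relation [a * a = a + ...] gives [c ^ 2 = c] for the unit [c = g a a]. *)
Let col_a i : g i inA = (i == inA)%:R.
Proof.
have gA j : j != inA -> g j inA = 0.
  move=> jA; apply: g_block; apply: contra jA.
  by case: j => [?|[o|[?|[?|?]]]] //; rewrite (ord1 o).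
have [->|iA] := eqVneq i inA; last exact: gA.
have := g_mul inA inA inA.
rewrite (bigD1 inA) //= big1 ?addr0; last first.
  move=> p pA; case: (eqVneq (sort_index p) 1%N) => [p1|p1]; last first.
    by rewrite g_block ?mul0r // eq_sym.
  by case: p pA p1 => [?|[o|[?|[?|?]]]] //; rewrite (ord1 o) eqxx.
rewrite (bigD1 inA) //= [X in _ + X]big1 ?addr0; last first.
  by move=> q qA; rewrite big1 // => s _; rewrite (gA _ qA) mulr0 mul0r.
rewrite (bigD1 inA) //= [X in _ + X]big1 ?addr0; last first.
  by move=> s sA; rewrite (gA _ sA) mulr0.
rewrite sorted_structure_NE //= scale1r mulr1 mul1r => cc.
have := gi_inv inA inA; rewrite (bigD1 inA) //= big1 ?addr0; last first.
  by move=> s sA; rewrite (gA _ sA) mulr0.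
move=> ci; transitivity (gi inA inA * (g inA inA * g inA inA)).
  by rewrite mulrA ci mul1r.
by rewrite -cc ci.
Qed.

Let mul_a l i : \sum_p g i p * t p inA l = \sum_s t i inA s * g s l.
Proof.
rewrite g_mul exchange_big; apply: eq_bigr => s _.
by rewrite -mulr_suml (delta_suml _ col_a).
Qed.

Let row_b s (F : I -> R) :
  \sum_p g (inB s) p * F p = \sum_s' g (inB s) (inB s') * F (inB s').
Proof.
rewrite big_basis_index !g_block // !mul0r !add0r.
by rewrite [X in _ + (X + _)]big1 => [|v _];
  rewrite ?[X in _ + (_ + X)]big1 ?addr0 // => *; rewrite g_block ?mul0r.
Qed.

Let row_u p (F : I -> R) :
  \sum_q g (inU p) q * F q = \sum_q g (inU p) (inU q) * F (inU q).
Proof.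
rewrite big_basis_index !g_block // !mul0r !add0r big1 => [|s _].
  by rewrite add0r big1 ?add0r // => v _; rewrite g_block ?mul0r.
by rewrite g_block ?mul0r.
Qed.

Let col_v v (F : I -> R) :
  \sum_q F q * g q (inV v) = \sum_v' F (inV v') * g (inV v') (inV v).
Proof.
rewrite big_basis_index !g_block // !mulr0 !add0r big1 => [|s _].
  by rewrite add0r [X in _ + X]big1 ?addr0 // => p _; rewrite g_block ?mulr0.
by rewrite g_block ?mulr0.
Qed.

Let col_u p (F : I -> R) :
  \sum_q F q * g q (inU p) = \sum_q F (inU q) * g (inU q) (inU p).
Proof.
rewrite big_basis_index !g_block // !mulr0 !add0r big1 => [|s _].
  by rewrite add0r big1 ?add0r // => v _; rewrite g_block ?mulr0.
by rewrite g_block ?mulr0.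
Qed.

(** Off the summand k^N, [g_block] applies. On it, the image of b_0 is the k^N-component of the
    identity g(a a) = a a, and each further vector follows from b_(s+1) = a b_s. *)
Let col_b s i : g i (inB s) = (i == inB s)%:R.
Proof.
have offB i' s' : sort_index i' != 2 -> g i' (inB s') = (i' == inB s')%:R.
  by move=> i2; rewrite g_block //; by case: (eqVneq i' _) i2 => [->|].
case: s => n; elim: n i => [|n IH] i lt_n.
  have [i2|/offB //] := eqVneq (sort_index i) 2.
  case: i i2 => [//|[//|[s _|[//|//]]]].
  have := mul_a inA (inB s); rewrite (delta_suml _ col_a) row_b.
  rewrite sorted_structure_NE // natr_alg => <-.
  rewrite (bigD1 (Ordinal lt_n)) //= sorted_structure_NE // natr_alg mulr1.
  rewrite big1 ?addr0 // => s' /negbTE s'0.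
  by rewrite sorted_structure_NE //= (_ : (_ == _) = false) ?scale0r ?mulr0.
have lt_n' := ltnW lt_n.
have [i2|/offB //] := eqVneq (sort_index i) 2.
case: i i2 => [//|[//|[s _|[//|//]]]].
have := mul_a (inB (Ordinal lt_n')) (inB s).
rewrite (delta_suml _ (fun i => IH i lt_n')) row_b.
rewrite sorted_structure_NE // natr_alg => <-.
rewrite (bigD1 (Ordinal lt_n)) //= sorted_structure_NE // natr_alg eqxx mulr1.
rewrite big1 ?addr0 // => s' /negbTE s'n.
by rewrite sorted_structure_NE //= (_ : (_ == _) = false) ?scale0r ?mulr0.
Qed.

Let g' v v' := g (inV v) (inV v').
Let gU p p' := g (inU p) (inU p').

Lemma automorphism_block i j : g i j = block_matrix g' gU i j.
Proof.
case: j => [o|[o|[s|[v|p]]]]; rewrite ?(ord1 o) ?col_e ?col_a ?col_b.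
- by case: i => [o'|[o'|[s'|[v'|p']]]] //; rewrite (ord1 o') eqxx.
- by case: i => [o'|[o'|[s'|[v'|p']]]] //; rewrite (ord1 o') eqxx.
- by case: i => [o'|[o'|[s'|[v'|p']]]].
- by case: i => [o'|[o'|[s'|[v'|p']]]] //=; rewrite g_block.
- by case: i => [o'|[o'|[s'|[v'|p']]]] //=; rewrite g_block.
Qed.

(** The four conditions are the U-components of the images of the products a a, a v, b_s u and v v',
    with a and the b_s already known to be fixed. *)
Lemma automorphism_block_morphism : block_morphism g' gU.
Proof.
split=> [p|p v|p s j|p v1 v2].
- have := mul_a inA (inU p); rewrite (delta_suml _ col_a) row_u => E.
  transitivity (\sum_q g (inU p) (inU q) * t (inU q) inA inA).
    by apply: eq_bigr => q _; rewrite sorted_structure_NE.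
  by rewrite E sorted_structure_NE.
- have := mul_a (inV v) (inU p); rewrite row_u col_v => E.
  transitivity (\sum_q g (inU p) (inU q) * t (inU q) inA (inV v)).
    by apply: eq_bigr => q _; rewrite sorted_structure_NE.
  by rewrite E; apply: eq_bigr => q _; rewrite sorted_structure_NE.
- have := g_mul (inU p) (inB (enum_rank s)) (inU j).
  rewrite row_u exchange_big /=.
  under [RHS]eq_bigr => q _ do rewrite -mulr_suml (delta_suml _ (col_b _)).
  rewrite col_u => E.
  transitivity (\sum_q g (inU p) (inU q) *
      t (inU q) (inB (enum_rank s)) (inU j)).
    by apply: eq_bigr => q _; rewrite sorted_structure_NE //= enum_rankK.
  rewrite E; apply: eq_bigr => q _.
  by rewrite sorted_structure_NE //= enum_rankK.
- have := g_mul (inU p) (inV v1) (inV v2).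
  rewrite row_u => E.
  transitivity (\sum_q g (inU p) (inU q) * t (inU q) (inV v1) (inV v2)).
    by apply: eq_bigr => q _; rewrite sorted_structure_NE.
  rewrite E exchange_big /=.
  under eq_bigr => q _ do rewrite -mulr_suml col_v.
  rewrite col_v [RHS]exchange_big; apply: eq_bigr => v2' _ /=.
  rewrite mulr_suml; apply: eq_bigr => v1' _.
  by rewrite sorted_structure_NE.
Qed.

End FromAutomorphism.

(** * Block matrices as automorphisms, and their composition *)

Section FromBlocks.
Variables (g' : V -> V -> R) (g : U -> U -> R).
Let B := block_matrix g' g.

Let zero_sum (J : finType) (F : J -> R) : (forall i, F i = 0) -> \sum_i F i = 0.
Proof. by move=> F0; rewrite big1. Qed.

Lemma block_row (F : I -> R) i : \sum_p B i p * F p =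
  match i with
  | inr (inr (inr (inl v))) => \sum_v' g' v v' * F (inV v')
  | inr (inr (inr (inr p))) => \sum_q g p q * F (inU q)
  | _ => F i
  end.
Proof.
have z (J : finType) (H : J -> R) : \sum_x 0 * H x = 0.
  by rewrite big1 // => x _; rewrite mul0r.
rewrite big_basis_index; case: i => [o|[o|[s|[v|p]]]] /=;
  rewrite ?(ord1 o) ?mul1r ?mul0r ?z ?add0r ?addr0 //.
rewrite (bigD1 s) //= eqxx mul1r big1 ?addr0 // => s' /negbTE.
by rewrite eq_sym => ->; rewrite mul0r.
Qed.

Lemma block_col (F : I -> R) j : \sum_q F q * B q j =
  match j with
  | inr (inr (inr (inl v))) => \sum_v' F (inV v') * g' v' v
  | inr (inr (inr (inr p))) => \sum_q F (inU q) * g q p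
  | _ => F j
  end.
Proof.
have z (J : finType) (H : J -> R) : \sum_x H x * 0 = 0.
  by rewrite big1 // => x _; rewrite mulr0.
rewrite big_basis_index; case: j => [o|[o|[s|[v|p]]]] /=;
  rewrite ?(ord1 o) ?mulr1 ?mulr0 ?z ?add0r ?addr0 //.
rewrite (bigD1 s) //= eqxx mulr1 big1 ?addr0 // => s' /negbTE.
by move=> ->; rewrite mulr0.
Qed.

Lemma block_multiplicative :
  block_morphism g' g -> multiplicative_matrix sorted_structure B.
Proof.
move=> [Hw Hi HD Hm] i j l; rewrite exchange_big /=.
under [RHS]eq_bigr => s _ do rewrite -mulr_suml.
have [->|jE] := eqVneq j inE.
  under [RHS]eq_bigr => s _ do rewrite block_col sorted_structure_EE.
  under [LHS]eq_bigr => p _ do rewrite sorted_structure_EE.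
  rewrite (delta_suml _ (j := l)) // (bigD1 i) //= eqxx mul1r.
  rewrite big1 ?addr0 // => s.
  by rewrite eq_sym => /negbTE ->; rewrite mul0r.
have [->|lE] := eqVneq l inE.
  rewrite sum_El block_col sum_Er.
  by case: i j {jE} => [o|[o|[s|[v|p]]]] [o'|[o'|[s'|[v'|p']]]];
    rewrite //= !mulr0.
under [RHS]eq_bigr => s _ do rewrite block_col.
rewrite block_row block_col.
case: j jE => [o|j0] jE; first by rewrite (ord1 o) in jE.
case: l lE => [o|l0] lE; first by rewrite (ord1 o) in lE.
case: j0 jE => [o|[s|[v|p]]] jE; case: l0 lE => [o'|[s'|[v'|p']]] lE;
case: i => [o''|[o''|[s''|[v''|p'']]]];
rewrite /sorted_structure /= ?scale0r //;
try by rewrite ?zero_sum // => ?; rewrite ?scale0r ?mulr0 ?mul0r //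
  zero_sum ?mul0r // => ?; rewrite ?scale0r ?mul0r.
(* The only case left is the product of two vectors of V, where the double sum of [Hm] has the other
   order of summation. *)
rewrite Hm exchange_big; apply: eq_bigr => v2 _ /=.
by rewrite mulr_suml.
Qed.

Lemma block_matrix_mul (h' : V -> V -> R) (h : U -> U -> R) i j :
  \sum_q B i q * block_matrix h' h q j =
  block_matrix (fun v v' => \sum_x g' v x * h' x v')
    (fun p p' => \sum_x g p x * h x p') i j.
Proof.
rewrite block_row.
by case: i j => [o|[o|[s|[v|p]]]] [o'|[o'|[s'|[v'|p']]]] //=;
  apply: zero_sum => x; rewrite mulr0.
Qed.

Lemma block_matrix1 i j :
    (forall v v', g' v v' = (v == v')%:R) ->
    (forall p p', g p p' = (p == p')%:R) ->
  B i j = (i == j)%:R.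
Proof.
move=> g'1 g1.
by case: i j => [o|[o|[s|[v|p]]]] [o'|[o'|[s'|[v'|p']]]] //=;
  rewrite ?g'1 ?g1 // (ord1 o) (ord1 o') eqxx.
Qed.

Lemma block_matrix_ext (h' : V -> V -> R) (h : U -> U -> R) i j :
  g' =2 h' -> g =2 h -> B i j = block_matrix h' h i j.
Proof.
by move=> gh' gh; case: i j => [o|[o|[s|[v|p]]]] [o'|[o'|[s'|[v'|p']]]] /=.
Qed.

End FromBlocks.
End Automorphisms.
End SortedAlgebra.

(** Induction on polynomials of degree at most [d], where monomials grow by one variable at a time.
    The step is required only below degree [d], so no product of larger degree has to be
    controlled. *)
Lemma mpoly_bounded_ind (k : fieldType) (m d : nat) (P : {mpoly k[m]} -> Prop) :
    P 0 -> (forall c p q, P p -> P q -> P (c *: p + q)) -> P 1 ->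
    (forall i w, (mdeg w < d)%N -> P 'X_[w] -> P ('X_i * 'X_[w])) ->
  forall p, (msize p <= d.+1)%N -> P p.
Proof.
move=> P0 PZD P1 PX p sp.
have PX' n w : (mdeg w <= d)%N -> mdeg w = n -> P 'X_[w].
  elim: n w => [|n IH] w wd wn.
    by move/eqP: wn; rewrite mdeg_eq0 => /eqP ->; rewrite mpolyX0.
  have [i wi] : exists i, w i != 0%N.
    apply/existsP; apply: contraPT wn => /existsPn w0.
    suff -> : w = 0%MM by rewrite mdeg0.
    by apply/mnmP => i; rewrite mnm0E; apply/eqP; have := w0 i; rewrite negbK.
  have E : w = (U_(i) + (w - U_(i)))%MM by rewrite addmC submK // lep1mP.
  have wn' : mdeg (w - U_(i))%MM = n.
    by move/eqP: wn; rewrite {1}E mdegD mdeg1 add1n => /eqP[].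
  rewrite E mpolyXD; apply: PX; first by rewrite wn' -wn.
  by apply: IH => //; rewrite wn'; lia.
rewrite [p]mpolyE big_seq; elim/big_rec: _ => // w q wp Pq; apply: PZD => //.
by apply: PX' (erefl _); rewrite -ltnS (leq_trans (msize_mdeg_lt wp)).
Qed.

Lemma peval_generators (k : fieldType) (A : comAlgType k) (m n : nat)
    (h : 'I_m -> A) (g : 'I_n -> A) :
    (forall i, exists p, peval g p = h i) ->
  forall p, exists q, peval g q = peval h p.
Proof.
move=> H p; elim/mpolyind: p => [|c w p _ _ [q qp]].
  by exists 0; rewrite !rmorph0.
suff [r rw] : exists r, peval g r = peval h 'X_[w].
  by exists (c *: r + q); rewrite !rmorphD /= !pevalZ qp rw.
rewrite mpolyXE_id rmorph_prod /=; elim/big_rec: _ => [|i _ _ [q' <-]].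
  by exists 1; rewrite rmorph1.
have [r rh] := H i; exists (r ^+ w i * q').
by rewrite rmorphM rmorphXn /= rh rmorphXn /= pevalX.
Qed.

Lemma span_mul (k : fieldType) (A : comAlgType k) (I J : finType)
    (b : I -> A) (c : J -> A) v w :
  span b v -> span c w -> span (fun p : I * J => b p.1 * c p.2) (v * w).
Proof.
move=> [beta ->] [gam ->]; rewrite big_distrlr /=.
apply: span_sum => i _; apply: span_sum => j _.
rewrite -scalerAl -scalerAr; do 2!apply: spanZ.
exact: (span_mem (fun p : I * J => b p.1 * c p.2) (i, j)).
Qed.

(** * The coordinate ring *)

Section ScalarInclusion.
Variables (k : fieldType) (R : comAlgType k).

(** The structure map as an algebra morphism from [k^o], along which the identity of G over [k] is
    carried to [R]. *)
Definition scalar_incl (c : k^o) : R := c%:A.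

Fact scalar_incl_zmod : zmod_morphism scalar_incl.
Proof. by move=> a b; rewrite /scalar_incl scalerBl. Qed.
Fact scalar_incl_monoid : monoid_morphism scalar_incl.
Proof.
split=> [|a b]; first exact: scale1r.
by rewrite /scalar_incl -scalerAl mul1r scalerA.
Qed.
Fact scalar_incl_scalable : scalable scalar_incl.
Proof. by move=> a b; rewrite /scalar_incl scalerA. Qed.

HB.instance Definition _ :=
  GRing.isZmodMorphism.Build k^o R scalar_incl scalar_incl_zmod.
HB.instance Definition _ :=
  GRing.isMonoidMorphism.Build k^o R scalar_incl scalar_incl_monoid.
HB.instance Definition _ :=
  GRing.isScalable.Build k k^o R _ scalar_incl scalar_incl_scalable.

End ScalarInclusion.

Lemma gf_map1 (k : fieldType) (G : group_functor k) (R S : comAlgType k)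
  (f : {lrmorphism R -> S}) : gf_map G f 1%g = 1%g.
Proof. by apply: (mulgI (gf_map G f 1%g)); rewrite -gmulfM !mulg1. Qed.

(** * Elements of [A] as functions on the points of G *)

Section CoordinateRing.
Variables (k : fieldType) (G : group_functor k) (A : comAlgType k) (u : G A).
Hypothesis (u_rep : represents u).

Fact ev_key (R : comAlgType k) (x : G R) :
  exists f : {lrmorphism A -> R}, gf_map G f u = x.
Proof. by have [f fu _] := u_rep x; exists f. Qed.

(** [ev x a] is the value of the function [a] at the point [x]; at the generic point [u] it is [a]
    itself. *)
Definition ev (R : comAlgType k) (x : G R) : {lrmorphism A -> R} :=
  sval (constructive_indefinite_description _ (ev_key x)).

Lemma evK (R : comAlgType k) (x : G R) : gf_map G (ev x) u = x.
Proof. by rewrite /ev; case: constructive_indefinite_description. Qed.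

Lemma ev_unique (R : comAlgType k) (f : {lrmorphism A -> R}) (x : G R) :
  gf_map G f u = x -> ev x =1 f.
Proof.
move=> fx a; have [g _ gP] := u_rep x.
by rewrite (gP _ fx) (gP _ (evK x)).
Qed.

Lemma ev_map (R S : comAlgType k) (f : {lrmorphism R -> S}) (x : G R) a :
  ev (gf_map G f x) a = f (ev x a).
Proof.
rewrite (ev_unique (f := f \o ev x)) //.
by rewrite (gf_map_comp f (ev x) u) /= evK.
Qed.

Lemma ev_generic a : ev u a = a.
Proof. by rewrite (ev_unique (f := idfun)) // gf_map_id. Qed.

Lemma ev_of (R : comAlgType k) (f : {lrmorphism A -> R}) :
  ev (gf_map G f u) =1 f.
Proof. exact: ev_unique. Qed.

Lemma ev_inj (R : comAlgType k) (x y : G R) : ev x =1 ev y -> x = y.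
Proof. by move=> /(@gf_map_ext _ G)/(_ u); rewrite !evK. Qed.

Definition counit (a : A) : k := ev (1%g : G k^o) a.

Lemma ev1 (R : comAlgType k) a : ev (1%g : G R) a = (counit a)%:A.
Proof.
by rewrite -(gf_map1 G (@scalar_incl k R)) ev_map.
Qed.

Hypothesis A_ft : finite_type_alg A.

(** An element of the tensor product of [A] and [R] that vanishes at all points of G over all
    [R]-algebras is zero: it suffices to take the tensor product as [S], with the image of the
    generic point. *)
Lemma pairing_inj (R : comAlgType k) (J : finType) (b : J -> A) (r : J -> R) :
    indep b ->
    (forall (S : comAlgType k) (f : {lrmorphism R -> S}) (x : G S),
      \sum_j ev x (b j) * f (r j) = 0) ->
  forall j, r j = 0.
Proof.
have [m [h hs]] := A_ft.
have [S [x [f [_ _ disj]]]] := @tensor_alg k A R m h hs.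
move=> ib E; apply: disj ib _; rewrite -[RHS](E S f (gf_map G x u)).
by apply: eq_bigr => j _; rewrite ev_of.
Qed.

Lemma pairing_eq (J : finType) (b : J -> A) (R : comAlgType k) (r r' : J -> R) :
    indep b ->
    (forall (S : comAlgType k) (f : {lrmorphism R -> S}) (y : G S),
      \sum_j ev y (b j) * f (r j) = \sum_j ev y (b j) * f (r' j)) ->
  forall j, r j = r' j.
Proof.
move=> ib E j; apply/eqP; rewrite -subr_eq0; apply/eqP; move: j.
apply: (pairing_inj ib) => S f y.
under eq_bigr => i _ do rewrite rmorphB mulrBr.
by rewrite sumrB E subrr.
Qed.

(** The comultiplication is the value of [a] at the product of the two generic points over the
    tensor square of [A]; every pair of points is a specialisation of that one. *)
Lemma comult (a : A) : exists s : seq (A * A),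
  forall (S : comAlgType k) (x y : G S),
    ev (x * y)%g a = \sum_(z <- s) ev x z.1 * ev y z.2.
Proof.
have [m [h hs]] := A_ft.
have [T [x [y [spn univ _]]]] := @tensor_alg k A A m h hs.
have [J [b [c abc]]] := spn (ev (gf_map G x u * gf_map G y u)%g a).
exists [seq (b j, c j) | j <- enum J] => S x' y'.
rewrite big_map big_enum.
have [g gx gy] := univ S (ev x') (ev y').
have gu (x0 : {lrmorphism A -> T}) z : (forall a, g (x0 a) = ev z a) ->
    gf_map G g (gf_map G x0 u) = z.
  move=> gz; apply: ev_inj => e; rewrite ev_map ev_of; exact: gz.
rewrite -{1}(gu _ _ gx) -{1}(gu _ _ gy) -gmulfM ev_map abc rmorph_sum.
apply: eq_bigr => j _; rewrite rmorphM /=.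
by congr (_ * _); [apply: gx | apply: gy].
Qed.

(** * Functions of two points in a product of two finite-dimensional spaces *)

Section Coefficients.
Variables (I J : finType) (b : I -> A) (c : J -> A).

(** The tensor product of the spans of [b] and [c], seen as natural functions on pairs of points;
    the coefficients [D] do not depend on [R]. *)
Definition bispan (phi : forall R : comAlgType k, G R -> G R -> R) : Prop :=
  exists D : I -> J -> k, forall (R : comAlgType k) (x y : G R),
    phi R x y = \sum_i \sum_j D i j *: (ev x (b i) * ev y (c j)).

Lemma bispan_ext phi psi : (forall R x y, phi R x y = psi R x y) ->
  bispan phi -> bispan psi.
Proof. by move=> E [D DP]; exists D => R x y; rewrite -E. Qed.

Lemma bispanD phi psi : bispan phi -> bispan psi ->
  bispan (fun R x y => phi R x y + psi R x y).
Proof.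
move=> [D DP] [E EP]; exists (fun i j => D i j + E i j) => R x y.
rewrite DP EP -big_split; apply: eq_bigr => i _ /=.
by rewrite -big_split; apply: eq_bigr => j _ /=; rewrite scalerDl.
Qed.

Lemma bispanZ a phi : bispan phi -> bispan (fun R x y => a *: phi R x y).
Proof.
move=> [D DP]; exists (fun i j => a * D i j) => R x y.
rewrite DP scaler_sumr; apply: eq_bigr => i _.
by rewrite scaler_sumr; apply: eq_bigr => j _; rewrite scalerA.
Qed.

Lemma bispan_sum (T : Type) (r : seq T)
    (phi : T -> forall R : comAlgType k, G R -> G R -> R) :
  (forall t, bispan (phi t)) ->
  bispan (fun R x y => \sum_(t <- r) phi t R x y).
Proof.
move=> H; elim: r => [|t r IH].
  exists (fun _ _ => 0) => R x y; rewrite big_nil big1 // => i _.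
  by rewrite big1 // => j _; rewrite scale0r.
by apply: bispan_ext (bispanD (H t) IH) => R x y; rewrite big_cons.
Qed.

Lemma bispan_mem v w : span b v -> span c w ->
  bispan (fun R x y => ev x v * ev y w).
Proof.
move=> [beta ->] [gam ->]; exists (fun i j => beta i * gam j) => R x y.
rewrite !linear_sum big_distrlr /=.
apply: eq_bigr => i _; apply: eq_bigr => j _.
by rewrite !linearZ /= -scalerAl -scalerAr scalerA.
Qed.

End Coefficients.

Lemma bispan_sub (I J I' J' : finType) (b : I -> A) (c : J -> A)
    (b' : I' -> A) (c' : J' -> A) phi :
  (forall i, span b' (b i)) -> (forall j, span c' (c j)) ->
  bispan b c phi -> bispan b' c' phi.
Proof.
move=> bb' cc' [D DP]; apply: bispan_ext (fun R x y => esym (DP R x y)) _.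
apply: bispan_sum => i; apply: bispan_sum => j; apply: bispanZ.
exact: bispan_mem.
Qed.

Lemma bispanM (I J I' J' : finType) (b : I -> A) (c : J -> A)
    (b' : I' -> A) (c' : J' -> A) phi psi :
  bispan b c phi -> bispan b' c' psi ->
  bispan (fun p : I * I' => b p.1 * b' p.2) (fun p : J * J' => c p.1 * c' p.2)
    (fun R x y => phi R x y * psi R x y).
Proof.
move=> [D DP] [E EP].
pose chi R (x y : G R) := \sum_i \sum_i' \sum_j \sum_j' (D i j * E i' j') *:
  (ev x (b i * b' i') * ev y (c j * c' j')).
apply: (@bispan_ext _ _ _ _ chi).
  move=> R x y; rewrite DP EP big_distrlr; apply: eq_bigr => i _.
  apply: eq_bigr => i' _; rewrite big_distrlr; apply: eq_bigr => j _.
  apply: eq_bigr => j' _ /=; rewrite -scalerAl -scalerAr scalerA !rmorphM.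
  by rewrite mulrACA.
apply: bispan_sum => i; apply: bispan_sum => i'; apply: bispan_sum => j.
apply: bispan_sum => j'; apply: bispanZ; apply: bispan_mem.
  exact: (span_mem (fun p : I * I' => b p.1 * b' p.2) (i, i')).
exact: (span_mem (fun p : J * J' => c p.1 * c' p.2) (j, j')).
Qed.

(** * Local finiteness: translation-stable subspaces and subcoalgebras *)

Definition comul_in (I J : finType) (b : I -> A) (c : J -> A) (a : A) : Prop :=
  bispan b c (fun R x y => ev (x * y)%g a).

Lemma comul_in_span (I J K : finType) (b : I -> A) (c : J -> A) (d : K -> A) a :
  (forall l, comul_in b c (d l)) -> span d a -> comul_in b c a.
Proof.
move=> H [e ->]; apply: (@bispan_ext _ _ _ _
    (fun R x y => \sum_l e l *: ev (x * y)%g (d l))).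
  by move=> R x y; rewrite linear_sum; apply: eq_bigr => l _; rewrite linearZ.
by apply: bispan_sum => l; apply: bispanZ; apply: H.
Qed.

(** The span of [b] is a subcomodule: for a fixed y, translating by x -> x y keeps it stable. *)
Definition right_stable (J : finType) (b : J -> A) : Prop :=
  forall j, exists (K : finType) (c : K -> A), comul_in b c (b j).

Definition subcoalgebra (J : finType) (b : J -> A) : Prop :=
  forall j, comul_in b b (b j).

Lemma right_stableP (J : finType) (b : J -> A) : right_stable b ->
  exists M : J -> J -> A, forall (R : comAlgType k) (x y : G R) j,
    ev (x * y)%g (b j) = \sum_i ev x (b i) * ev y (M i j).
Proof.
move=> bst; have /choose_fun[M MP] j : exists M : J -> A,
    forall (R : comAlgType k) (x y : G R),
      ev (x * y)%g (b j) = \sum_i ev x (b i) * ev y (M i).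
  have [K [c [D DP]]] := bst j; exists (fun i => \sum_l D i l *: c l) => R x y.
  rewrite DP; apply: eq_bigr => i _; rewrite linear_sum mulr_sumr.
  by apply: eq_bigr => l _; rewrite linearZ /= scalerAr.
by exists (fun i j => M j i).
Qed.

(** Write a(x y) as the sum of the b_l(x) e_l(y) with the e_l independent. Comparing the two
    bracketings of a(x y z) along the e_l expresses b_l(x y) through the b_i(x), so the b_l span a
    stable space. *)
Lemma right_stable_hull1 a : exists (J : finType) (b : J -> A),
  right_stable b /\ span b a.
Proof.
have comult_basis a' (s : seq (A * A)) (W : finType) (w : W -> A) :
    (forall (S : comAlgType k) (x y : G S),
      ev (x * y)%g a' = \sum_(z <- s) ev x z.1 * ev y z.2) ->
    (forall z, z \in s -> span w z.2) ->
  exists p : W -> A, forall (S : comAlgType k) (x y : G S),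
    ev (x * y)%g a' = \sum_l ev x (p l) * ev y (w l).
  move=> as_ sw; have /choose_fun[g gP] : forall i : 'I_(size s),
    span w (tnth (in_tuple s) i).2 by move=> i; apply/sw/mem_tnth.
  exists (fun l => \sum_i g i l *: (tnth (in_tuple s) i).1) => S x y.
  rewrite as_ big_tnth.
  under [RHS]eq_bigr => l _ do rewrite linear_sum mulr_suml.
  rewrite exchange_big; apply: eq_bigr => i _ /=.
  rewrite {1}gP linear_sum mulr_sumr; apply: eq_bigr => l _.
  by rewrite !linearZ /= -scalerAl -scalerAr.
have [s as_] := comult a.
have [E [e [ie es _]]] := basis_exists [seq z.2 | z <- s].
have [b bP] : exists b : E -> A, forall (S : comAlgType k) (x y : G S),
    ev (x * y)%g a = \sum_l ev x (b l) * ev y (e l).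
  by apply: comult_basis as_ _ => z zs; apply/es/map_f.
have /choose_fun[t tP] := fun l : E => comult (e l).
have [K [d [id_ ds _]]] :=
  indep_extend (flatten [seq [seq z.2 | z <- t l] | l <- enum E]) ie.
have /choose_fun[p pP] : forall l : E, exists p : E + K -> A,
    forall (S : comAlgType k) (x y : G S),
    ev (x * y)%g (e l) = \sum_w ev x (p w) * ev y (join_family e d w).
  move=> l; apply: comult_basis (tP l) _ => z zt; apply: ds.
  apply/flatten_mapP; exists l; first by rewrite mem_enum.
  exact: map_f.
have bM (R : comAlgType k) (x y : G R) l' :
    ev (x * y)%g (b l') = \sum_l ev x (b l) * ev y (p l (inl l')).
  (* Coefficients of the difference of the two expansions of a(x y z), as a function of z, along the
     independent family extending the e_l. *)
  pose r (w : E + K) : R := (if w is inl l then ev (x * y)%g (b l) else 0)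
    - \sum_l ev x (b l) * ev y (p l w).
  suff r0 : forall w, r w = 0.
    by apply/eqP; rewrite -subr_eq0; apply/eqP/(r0 (inl l')).
  apply: (pairing_inj id_) => S f z.
  under eq_bigr => w _ do rewrite /r rmorphB mulrBr.
  rewrite sumrB big_sumType /= [X in _ + X - _]big1 ?addr0; last first.
    by move=> i _; rewrite rmorph0 mulr0.
  apply/eqP; rewrite subr_eq0; apply/eqP.
  transitivity (ev (gf_map G f x * gf_map G f y * z)%g a).
    rewrite bP; apply: eq_bigr => l _.
    by rewrite -gmulfM ev_map mulrC.
  rewrite -mulgA bP; under [LHS]eq_bigr => l _ do rewrite pP mulr_sumr.
  rewrite exchange_big; apply: eq_bigr => w _ /=.
  rewrite rmorph_sum mulr_sumr; apply: eq_bigr => l _.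
  by rewrite rmorphM !ev_map mulrA mulrC.
exists E, b; split=> [l|].
  exists E, (fun l' => p l' (inl l)); apply: bispan_ext.
    by move=> R x y; rewrite bM.
  apply: bispan_sum => l'; apply: bispan_mem; first exact: span_mem.
  exact: (span_mem (fun l' => p l' (inl l))).
(* Evaluating a(x y) at the generic point and the identity gives [a] as a combination of the b_l. *)
exists (fun l => counit (e l)).
rewrite -{1}(ev_generic a) -(mulg1 u) bP.
by apply: eq_bigr => l _; rewrite ev1 ev_generic mulr_algr.
Qed.

Lemma right_stable_hull (s : seq A) : exists (J : finType) (b : J -> A),
  right_stable b /\ forall a, a \in s -> span b a.
Proof.
elim: s => [|a s [J [b [bst bs]]]]; first by exists void, (of_void A); split.
have [K [c [cst ca]]] := right_stable_hull1 a.
exists (K + J)%type, (join_family c b); split=> [[j|j]|v].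
- have [L [d dP]] := cst j; exists L, d; apply: bispan_sub dP => // i.
    exact: (span_mem (join_family c b) (inl i)).
  exact: span_mem.
- have [L [d dP]] := bst j; exists L, d; apply: bispan_sub dP => // i.
    exact: (span_mem (join_family c b) (inr i)).
  exact: span_mem.
- rewrite inE => /predU1P[->|/bs]; first exact: span_joinl.
  exact: span_joinr.
Qed.

Lemma right_stable_basis (J K : finType) (b : J -> A) (d : K -> A) :
  (forall j, span d (b j)) -> (forall i, span b (d i)) ->
  right_stable b -> right_stable d.
Proof.
move=> db bd bst.
have [M MP] := right_stableP bst.
move=> i; exists (J * J)%type, (fun p => M p.1 p.2).
apply: comul_in_span (bd i) => j.
apply: bispan_ext (fun R x y => esym (MP R x y j)) _.
apply: bispan_sum => l; apply: bispan_mem => //.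
exact: (span_mem (fun p : J * J => M p.1 p.2) (l, j)).
Qed.

Lemma subcoalgebra_basis (J K : finType) (b : J -> A) (d : K -> A) :
  (forall j, span d (b j)) -> (forall i, span b (d i)) ->
  subcoalgebra b -> subcoalgebra d.
Proof.
move=> db bd bst i; apply: comul_in_span (bd i) => j.
exact: bispan_sub (bst j).
Qed.

Lemma subcoalgebraM (J K : finType) (b : J -> A) (c : K -> A) :
  subcoalgebra b -> subcoalgebra c ->
  subcoalgebra (fun p : J * K => b p.1 * c p.2).
Proof.
move=> bst cst [j l]; apply: bispan_ext (bispanM (bst j) (cst l)) => R x y.
by rewrite rmorphM.
Qed.

(** The two bracketings of x y z give two expansions of b_j(x y z) along the independent b_i(x),
    whose coefficients must agree. *)
Lemma matrix_coefM (J : finType) (b : J -> A) (M : J -> J -> A) : indep b ->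
    (forall (R : comAlgType k) (x y : G R) j,
      ev (x * y)%g (b j) = \sum_i ev x (b i) * ev y (M i j)) ->
  forall (R : comAlgType k) (x y : G R) i j,
    ev (x * y)%g (M i j) = \sum_l ev x (M i l) * ev y (M l j).
Proof.
move=> ib MP R y z i j; move: i; apply: (pairing_eq ib) => S f x.
transitivity (ev (x * (gf_map G f y * gf_map G f z))%g (b j)).
  by rewrite MP; apply: eq_bigr => i _; rewrite -gmulfM ev_map.
rewrite mulgA MP; under [LHS]eq_bigr => l _ do rewrite MP mulr_suml.
rewrite exchange_big; apply: eq_bigr => i _ /=.
rewrite rmorph_sum mulr_sumr; apply: eq_bigr => l _.
by rewrite rmorphM !ev_map mulrA.
Qed.

(** Matrix coefficients of the right translations on a stable space span a subcoalgebra. It contains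
    the space itself, since b_j(1 u) is the sum of the b_i(1) M_ij(u). *)
Lemma subcoalgebra_hull (s : seq A) : exists (J : finType) (b : J -> A),
  subcoalgebra b /\ forall a, a \in s -> span b a.
Proof.
have [J0 [b0 [st0 s0]]] := right_stable_hull s.
have [J [b [ib bb0 b0b]]] := basis_of_family b0.
have [M MP] := right_stableP (right_stable_basis bb0 b0b st0).
pose m (p : J * J) := M p.1 p.2.
exists (J * J)%type, m; split=> [[i j]|a /s0 sa].
  apply: bispan_ext (fun R x y => esym (matrix_coefM ib MP x y i j)) _.
  apply: bispan_sum => l; apply: bispan_mem.
    exact: (span_mem m (i, l)).
  exact: (span_mem m (l, j)).
apply: (@span_trans _ _ _ _ b0) => // {sa}j; apply: span_trans (bb0 j) => {}j.
rewrite -(ev_generic (b j)) -(mul1g u) MP; apply: span_sum => i _.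
rewrite ev1 ev_generic mulr_algl; apply: spanZ; exact: (span_mem m (i, j)).
Qed.

Lemma subcoalgebra_generators : exists (m : nat) (h : 'I_m -> A),
  [/\ forall a, exists p, peval h p = a, subcoalgebra h & span h 1].
Proof.
have [m0 [h0 h0s]] := A_ft.
have [J [b [bco bs]]] := subcoalgebra_hull (1 :: [seq h0 i | i <- enum 'I_m0]).
pose h (i : 'I_#|J|) := b (enum_val i).
have hb i : span b (h i) by apply: span_mem.
have bh j : span h (b j).
  by rewrite -(enum_rankK j); apply: (span_mem h (enum_rank j)).
exists #|J|, h; split.
- move=> a; have [p <-] := h0s a; apply: (peval_generators (h := h0)) => i.
  have [c ->] : span h (h0 i).
    apply: span_trans bh _; apply: bs.
    by rewrite inE map_f ?orbT ?mem_enum.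
  exists (\sum_j c j *: 'X_j); rewrite rmorph_sum; apply: eq_bigr => j _ /=.
  by rewrite pevalZ pevalX.
- exact: subcoalgebra_basis bco.
- by apply: span_trans bh _; apply: bs; rewrite mem_head.
Qed.

(** The [d]-fold products of the generators; as 1 is in the span of [h], they also reach all lower
    degrees. *)
Lemma subcoalgebra_powers (m : nat) (h : 'I_m -> A) (d : nat) :
    subcoalgebra h -> span h 1 ->
  exists (J : finType) (v : J -> A), [/\ subcoalgebra v,
    forall p, (msize p <= d.+1)%N -> span v (peval h p) &
    forall j, exists2 p, (msize p <= d.+1)%N & v j = peval h p].
Proof.
move=> hco h1; elim: d => [|d [J [v [vco sv vp]]]].
  exists 'I_1, (fun=> 1); split=> [j|p /msize1_polyC ->|j].
  - apply: (@bispan_ext _ _ _ _ (fun R x y => ev x 1 * ev y 1)).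
      by move=> R x y; rewrite !rmorph1 mulr1.
    by apply: bispan_mem; apply: (span_mem (fun=> 1) j).
  - by rewrite pevalC; apply: spanZ; apply: (span_mem (fun=> 1) ord0).
  - by exists 1; rewrite ?rmorph1 // msize1.
exists ('I_m * J)%type, (fun p => h p.1 * v p.2); split.
- exact: subcoalgebraM.
- apply: mpoly_bounded_ind => [|c p q Pp Pq||i w wd _].
  + by rewrite rmorph0; apply: span0.
  + by rewrite rmorphD /= pevalZ; apply: spanD => //; apply: spanZ.
  + rewrite rmorph1 -(mulr1 1); apply: span_mul => //.
    by rewrite -(rmorph1 (peval h)); apply: sv; rewrite msize1.
  + rewrite rmorphM /= pevalX; apply: span_mul; first exact: span_mem.
    by apply: sv; rewrite msizeX.
- move=> [i j]; have [p pd ->] := vp j; exists ('X_i * p).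
    have [->|pn0] := eqVneq p 0; first by rewrite mulr0 msize0.
    have Xn0 : 'X_i != 0 :> {mpoly k[m]}.
      by apply/eqP => E; have := msizeX k U_(i)%MM; rewrite E msize0.
    by rewrite msizeM // msizeX mdeg1 !addSn add0n ltnS.
  by rewrite rmorphM /= pevalX.
Qed.

(* The family [v] contains all polynomials in some generators up to the degree
   of a finite set of defining relations, so that these relations are visible
   in the products of pairs of elements of [v]. *)
Lemma coordinate_ring_presentation :
  exists (U V : finType) (u0 : U -> A) (v : V -> A)
    (iota : V -> U -> k) (mu : V -> V -> U -> k) (w : U -> k),
  [/\ [/\ indep u0, indep v, subcoalgebra u0 & right_stable v],
    [/\ forall j, v j = \sum_l iota j l *: u0 l,
      forall i j, v i * v j = \sum_l mu i j l *: u0 l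
      & 1 = \sum_l w l *: u0 l],
    forall (R : comAlgType k) (psi : U -> R), \sum_l w l *: psi l = 1 ->
      (forall i j, \sum_l mu i j l *: psi l =
        (\sum_l iota i l *: psi l) * (\sum_l iota j l *: psi l)) ->
      exists f : {lrmorphism A -> R}, forall l, f (u0 l) = psi l
    & forall (R : comAlgType k) (f g : {lrmorphism A -> R}),
      (forall l, f (u0 l) = g (u0 l)) -> f =1 g].
Proof.
have [m [h [h_surj hco h1]]] := subcoalgebra_generators.
have [s s0 sker] := noetherian_mpoly (ideal_ker (peval h)).
(* The bound covers the finitely many relations, and [d > 0] makes the generators themselves have
   admissible degree. *)
have [d [d0 sd]] : exists d, (0 < d)%N /\
    forall p, p \in s -> (msize p <= d.+1)%N.
  elim: {s0 sker} s => [|p s [d [d0 sd]]]; first by exists 1%N.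
  exists (maxn d (msize p)); split; first by rewrite leq_max d0.
  move=> q; rewrite inE => /predU1P[->|/sd qd].
    by rewrite leqW // leq_maxr.
  by rewrite (leq_trans qd) // ltnS leq_maxl.
have [J [v0 [v0co sv0 v0p]]] := subcoalgebra_powers d hco h1.
have [V [v [iv vv0 v0v]]] := basis_of_family v0.
have v01 : span v0 1.
  by rewrite -(rmorph1 (peval h)); apply: sv0; rewrite msize1.
(* U is the space of products of pairs from V; it contains V because V contains 1. *)
pose u1 (p : J * J) := v0 p.1 * v0 p.2.
have [U [u0 [iu uu1 u1u]]] := basis_of_family u1.
have uv0 a : span v0 a -> span u0 a.
  by move=> sa; apply: span_trans uu1 _; rewrite -(mulr1 a); apply: span_mul.
have vp p : (msize p <= d.+1)%N -> span v (peval h p).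
  by move=> pd; apply: span_trans vv0 _; apply: sv0.
have /choose_fun[iota iotaP] : forall j, span u0 (v j).
  by move=> j; apply: uv0.
have /choose_fun[mu0 mu0P] : forall z : V * V, span u0 (v z.1 * v z.2).
  by move=> z; apply: span_trans uu1 _; apply: span_mul.
have [w wP] := uv0 _ v01.
have uh i : span u0 (h i).
  by apply: uv0; rewrite -pevalX; apply: sv0; rewrite msizeX mdeg1.
exists U, V, u0, v, iota, (fun i j => mu0 (i, j)), w; split; first split=> //.
- exact: subcoalgebra_basis uu1 u1u (subcoalgebraM v0co v0co).
- apply: right_stable_basis vv0 v0v _ => j.
  by exists J, v0; apply: v0co.
- by split=> // i j; rewrite -mu0P.
- move=> R psi psi1 psiM.
  (* The linear map from U to [R] given by [psi], as a relation on all of [A]; independence of [u0]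
     makes it functional. *)
  pose graph a r := exists2 c : U -> k, a = \sum_l c l *: u0 l &
    r = \sum_l c l *: psi l.
  have graph_fun a r r' : graph a r -> graph a r' -> r = r'.
    move=> [c -> ->] [c' E ->]; apply: eq_bigr => l _.
    by rewrite (indep_inj iu E).
  have graph0 : graph 0 0.
    by exists (fun=> 0); rewrite big1 // => l _; rewrite scale0r.
  have graphZD c a r a' r' : graph a r -> graph a' r' ->
      graph (c *: a + a') (c *: r + r').
    move=> [e -> ->] [e' -> ->]; exists (fun l => c * e l + e' l).
      rewrite scaler_sumr -big_split; apply: eq_bigr => l _ /=.
      by rewrite scalerDl scalerA.
    rewrite scaler_sumr -big_split; apply: eq_bigr => l _ /=.
    by rewrite scalerDl scalerA.
  have graph_sum (I : finType) (c : I -> k) F f :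
      (forall i, graph (F i) (f i)) ->
      graph (\sum_i c i *: F i) (\sum_i c i *: f i).
    by move=> H; elim/big_ind2: _ => // [a r a' r' ga ga'|i _];
       [ have := graphZD 1 _ _ _ _ ga ga'
       | have := graphZD (c i) _ _ _ _ (H i) graph0 ];
       rewrite ?scale1r ?addr0.
  have graphM a r b t : span v a -> span v b -> graph a r -> graph b t ->
      graph (a * b) (r * t).
    move=> [al aE] [be bE].
    have gv i : graph (v i) (\sum_l iota i l *: psi l) by exists (iota i).
    have := graph_sum _ al _ _ gv; rewrite -aE => ga /(graph_fun _ _ _ ga) <-.
    have := graph_sum _ be _ _ gv; rewrite -bE => gb /(graph_fun _ _ _ gb) <-.
    have distr (B : comAlgType k) (F : V -> B) :
        (\sum_i al i *: F i) * (\sum_j be j *: F j) =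
        \sum_i al i *: \sum_j be j *: (F i * F j).
      rewrite mulr_suml; apply: eq_bigr => i _; rewrite -scalerAl mulr_sumr.
      by congr (_ *: _); apply: eq_bigr => j _; rewrite scalerAr.
    rewrite aE bE !distr; apply: (graph_sum) => i; apply: graph_sum => j.
    by exists (mu0 (i, j)); rewrite ?psiM // -mu0P.
  have /choose_fun[y yP] : forall i, exists r, graph (h i) r.
    by move=> i; have [c hc] := uh i; exists (\sum_l c l *: psi l), c.
  (* Up to degree [d], [psi] agrees with evaluation at [y]: in each step both factors lie in V,
     where [psi] is multiplicative. So [y] satisfies the defining relations. *)
  have graph_peval : forall p, (msize p <= d.+1)%N ->
      graph (peval h p) (peval y p).
    apply: mpoly_bounded_ind => [|c p q gp gq||i z zd gz].
    - by rewrite !rmorph0.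
    - by rewrite !rmorphD /= !pevalZ; apply: graphZD.
    - by rewrite !rmorph1; exists w.
    - rewrite !rmorphM /= !pevalX; apply: graphM => //; last first.
        by apply: vp; rewrite msizeX ltnS ltnW.
      by rewrite -pevalX; apply: vp; rewrite msizeX mdeg1.
  have y_ker p : peval h p = 0 -> peval y p = 0.
    move=> /sker/(_ (fun q => peval y q = 0)); apply; first exact: ideal_ker.
    move=> q qs; apply: (graph_fun 0) => //.
    by rewrite -(s0 _ qs); apply: graph_peval; apply: sd.
  have [c|f fP] := alg_descent h_surj y_ker.
    by exists c%:MP; rewrite pevalC.
  exists f => l; apply: (graph_fun (u0 l)); last first.
    exists (fun i => (i == l)%:R).
      rewrite (bigD1 l) //= eqxx scale1r big1 ?addr0 // => i /negbTE ->.
      by rewrite scale0r.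
    rewrite (bigD1 l) //= eqxx scale1r big1 ?addr0 // => i /negbTE ->.
    by rewrite scale0r.
  (* Each u_l is a combination of products of pairs from V, on which the morphism [f] and [psi]
     agree. *)
  have [c ->] := u1u l; rewrite linear_sum /=.
  under [X in graph _ X]eq_bigr => i _ do rewrite linearZ.
  apply: graph_sum => -[i j]; rewrite /u1 /= rmorphM.
  have [p pd pE] := v0p i; have [q qd qE] := v0p j.
  have gf z q' : (msize q' <= d.+1)%N -> z = peval h q' -> graph z (f z).
    by move=> q'd ->; rewrite fP; apply: graph_peval.
  by apply: graphM => //; [apply: gf pE | apply: gf qE].
move=> R f g fg a; have [p <-] := h_surj a.
rewrite !lrmorph_peval; apply: peval_ext => i; have [c ->] := uh i.
by rewrite !linear_sum; apply: eq_bigr => l _; rewrite !linearZ /= fg.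
Qed.

Lemma matrix_coef1 (J : finType) (b : J -> A) (M : J -> J -> A) : indep b ->
    (forall (R : comAlgType k) (x y : G R) j,
      ev (x * y)%g (b j) = \sum_i ev x (b i) * ev y (M i j)) ->
  forall (R : comAlgType k) i j, ev (1%g : G R) (M i j) = (i == j)%:R.
Proof.
move=> ib MP R i j; move: i; apply: (pairing_eq ib) => S f x.
transitivity (ev (x * gf_map G f 1)%g (b j)).
  by rewrite MP; apply: eq_bigr => i _; rewrite ev_map.
rewrite gf_map1 mulg1; under eq_bigr => i _ do rewrite rmorph_nat.
by rewrite (delta_suml _ (j := j)).
Qed.

(** * Points of G as the automorphisms of the structure on U and V *)

Section Representation.
Variables (U V : finType) (u0 : U -> A) (v : V -> A).
Variables (iota : V -> U -> k) (mu : V -> V -> U -> k) (w : U -> k).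
Variables (D : U -> U -> U -> k) (P : V -> V -> A).
Hypotheses (iu : indep u0) (iv : indep v).
Hypothesis DP : forall j (R : comAlgType k) (x y : G R),
  ev (x * y)%g (u0 j) = \sum_i \sum_l D j i l *: (ev x (u0 i) * ev y (u0 l)).
Hypothesis PP : forall (R : comAlgType k) (x y : G R) j,
  ev (x * y)%g (v j) = \sum_i ev x (v i) * ev y (P i j).
Hypothesis vE : forall j, v j = \sum_l iota j l *: u0 l.
Hypothesis muE : forall i j, v i * v j = \sum_l mu i j l *: u0 l.
Hypothesis wE : 1 = \sum_l w l *: u0 l.

(** Matrix coefficients of right translation on U. U being a subcoalgebra, they lie in U, so a
    linear form on U can be evaluated on them. *)
Definition translation_coef (i j : U) : A := \sum_l D j i l *: u0 l.
Local Notation N := translation_coef.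

Lemma translationE (R : comAlgType k) (x y : G R) j :
  ev (x * y)%g (u0 j) = \sum_i ev x (u0 i) * ev y (N i j).
Proof.
rewrite DP; apply: eq_bigr => i _; rewrite linear_sum mulr_sumr.
by apply: eq_bigr => l _; rewrite linearZ /= scalerAr.
Qed.

Lemma ev_lincomb (J : finType) (b : J -> A) (R : comAlgType k) (x : G R)
    (c : J -> k) :
  \sum_j ev x (b j) * (c j)%:A = ev x (\sum_j c j *: b j).
Proof.
rewrite linear_sum; apply: eq_bigr => j _.
by rewrite linearZ mulr_algr.
Qed.

Lemma ev_pair_sum (J : finType) (R : comAlgType k) (y : G R) (c : J -> U -> k)
    (r : J -> R) :
  \sum_p ev y (u0 p) * (\sum_a (c a p)%:A * r a) =
  \sum_a ev y (\sum_p c a p *: u0 p) * r a.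
Proof.
under eq_bigr => p _ do rewrite mulr_sumr.
rewrite exchange_big; apply: eq_bigr => a _ /=.
by rewrite -ev_lincomb mulr_suml; apply: eq_bigr => p _; rewrite mulrA.
Qed.

Lemma lrmorph_lincomb (J : finType) (R S : comAlgType k)
    (f : {lrmorphism R -> S}) (c : J -> k) (r : J -> R) :
  f (\sum_a (c a)%:A * r a) = \sum_a (c a)%:A * f (r a).
Proof.
rewrite rmorph_sum; apply: eq_bigr => a _.
by rewrite rmorphM /= rmorph_alg.
Qed.

Lemma translation_pairing (R S : comAlgType k) (f : {lrmorphism R -> S})
    (x : G R) (y : G S) (c : U -> k) :
  \sum_p ev y (u0 p) * f (\sum_q ev x (N p q) * (c q)%:A) =
  ev (y * gf_map G f x)%g (\sum_q c q *: u0 q).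
Proof.
rewrite -ev_lincomb.
under [RHS]eq_bigr => q _ do rewrite translationE mulr_suml.
rewrite exchange_big; apply: eq_bigr => p _ /=.
rewrite rmorph_sum mulr_sumr; apply: eq_bigr => q _.
by rewrite rmorphM /= rmorph_alg ev_map mulrA.
Qed.

(** Each identity is tested against the values u_p(y) at all points y. The conditions on unit,
    inclusion and product become identities between functions at y x; the one on [D] says that left
    and right translations commute. *)
Lemma translation_block_morphism (R : comAlgType k) (x : G R) :
  block_morphism D iota mu w
    (fun a b => ev x (P a b)) (fun p q => ev x (N p q)).
Proof.
split=> [||p s j|p v1 v2].
- apply: (pairing_eq iu) => S f y.
  rewrite translation_pairing -wE rmorph1.
  under eq_bigr => i _ do rewrite rmorph_alg.
  by rewrite ev_lincomb -wE rmorph1.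
- move=> p a; move: p; apply: (pairing_eq iu) => S f y.
  rewrite translation_pairing -vE PP.
  under [RHS]eq_bigr => i _ do rewrite lrmorph_lincomb.
  rewrite ev_pair_sum; apply: eq_bigr => b _.
  by rewrite -vE ev_map.
- move: p; apply: (pairing_eq iu) => S f y.
  rewrite translation_pairing -/(N s j) (matrix_coefM iu translationE).
  under [RHS]eq_bigr => i _ do rewrite lrmorph_lincomb.
  rewrite ev_pair_sum; apply: eq_bigr => b _.
  by rewrite ev_map.
- move: p; apply: (pairing_eq iu) => S f y.
  rewrite translation_pairing -muE rmorphM /= !PP.
  under [RHS]eq_bigr => i _.
    rewrite (eq_bigr (fun a => \sum_b (mu a b i)%:A *
      (ev x (P a v1) * ev x (P b v2)))).
      rewrite pair_bigA (lrmorph_lincomb f (fun z => mu z.1 z.2 i)).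
      over.
    by move=> a _; apply: eq_bigr => b _; rewrite mulrA.
  rewrite (ev_pair_sum _ (fun z p => mu z.1 z.2 p)) big_distrlr pair_bigA.
  apply: eq_bigr => -[a b] _ /=.
  by rewrite -muE !rmorphM /= !ev_map mulrACA.
Qed.

Hypothesis ext : forall (R : comAlgType k) (psi : U -> R),
  \sum_l w l *: psi l = 1 ->
  (forall i j, \sum_l mu i j l *: psi l =
    (\sum_l iota i l *: psi l) * (\sum_l iota j l *: psi l)) ->
  exists f : {lrmorphism A -> R}, forall l, f (u0 l) = psi l.

(** Composing [g] with evaluation at the identity gives a linear form on U that preserves 1 and the
    products from V, hence a point x. Commutation with the left translations then makes [g] the
    right translation by x. *)
Lemma block_morphism_point (R : comAlgType k) (g' : V -> V -> R)
    (g : U -> U -> R) :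
  block_morphism D iota mu w g' g ->
  exists x : G R, (forall a b, g' a b = ev x (P a b)) /\
    forall p q, g p q = ev x (N p q).
Proof.
move=> [Hw Hi HD Hm]; pose o := 1%g : G R.
pose psi l := \sum_i ev o (u0 i) * g i l.
have psiE (c : U -> k) : \sum_l c l *: psi l =
    \sum_i ev o (u0 i) * (\sum_l g i l * (c l)%:A).
  under [RHS]eq_bigr => i _ do rewrite mulr_sumr.
  rewrite exchange_big; apply: eq_bigr => l _ /=; rewrite scaler_sumr.
  by apply: eq_bigr => i _; rewrite mulr_algr scalerAr.
have psi_iota a : \sum_l iota a l *: psi l = \sum_b ev o (v b) * g' b a.
  rewrite psiE; under eq_bigr => i _ do rewrite Hi.
  by rewrite ev_pair_sum; apply: eq_bigr => b _; rewrite -vE.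
have [f fP] : exists f : {lrmorphism A -> R}, forall l, f (u0 l) = psi l.
  apply: ext => [|i j].
    rewrite psiE; under eq_bigr => i _ do rewrite Hw.
    by rewrite ev_lincomb -wE rmorph1.
  rewrite psiE !psi_iota.
  under eq_bigr => p _.
    rewrite Hm (eq_bigr (fun a => \sum_b (mu a b p)%:A * (g' a i * g' b j))).
      rewrite pair_bigA.
      over.
    by move=> a _; apply: eq_bigr => b _; rewrite mulrA.
  rewrite (ev_pair_sum _ (fun z p => mu z.1 z.2 p)) big_distrlr pair_bigA.
  apply: eq_bigr => -[a b] _ /=.
  by rewrite -muE rmorphM /= mulrACA.
pose x : G R := gf_map G f u.
have gE p q : g p q = ev x (N p q).
  rewrite /N linear_sum.
  under [RHS]eq_bigr => l _ do rewrite linearZ /= ev_of fP.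
  rewrite psiE; under [RHS]eq_bigr => i _ do rewrite HD.
  rewrite ev_pair_sum.
  under [RHS]eq_bigr => b _ do
    rewrite -/(N p b) (matrix_coef1 iu translationE) eq_sym mulrC.
  by rewrite (delta_suml _ (j := p)).
(* [g'] is recovered from [g] through the inclusion: tested against values of the independent family
   [v], both candidates are determined by their images under [iota]. *)
exists x; split=> // a b; move: a; apply: (pairing_eq iv) => S h y.
have [_ Hi' _ _] := translation_block_morphism x.
have pv (r : V -> R) : \sum_j ev y (v j) * h (r j) =
    \sum_p ev y (u0 p) * h (\sum_a (iota a p)%:A * r a).
  under [RHS]eq_bigr => i _ do rewrite lrmorph_lincomb.
  by rewrite ev_pair_sum; apply: eq_bigr => c _; rewrite -vE.
rewrite !pv; apply: eq_bigr => p _; rewrite -Hi -Hi'; congr (_ * h _).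
by apply: eq_bigr => q _; rewrite gE.
Qed.

End Representation.

(** The isomorphism sends x to the block matrix of right translation by x on V and U, with identity
    blocks on e, a and k^N. *)
Lemma stabilizer_isomorphic (la : nat -> k) : la 0 = 1 ->
    (forall i j, (i < 5)%N -> (j < 5)%N -> la i = la j -> i = j) ->
    (forall i, (i < 5)%N -> la i != 0) ->
  exists (n : nat) (t : 'cV[k]_(n * n * n)), gf_isomorphic G (stabilizer t).
Proof.
move=> la0 la_inj la_neq0.
have [U [V [u0 [v [iota [mu [w [[iu iv uco vst] [vE muE wE] ext gen]]]]]]]] :=
  coordinate_ring_presentation.
have /choose_fun[D DP] := uco.
have [P PP] := right_stableP vst.
have NP := translationE DP.
pose N := translation_coef u0 D.
pose T := sorted_structure D iota mu w la.
pose B (R : comAlgType k) (x : G R) :=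
  block_matrix (fun a b => ev x (P a b)) (fun p q => ev x (N p q)).
have BM (R : comAlgType k) (x y : G R) i j :
    \sum_q B R x i q * B R y q j = B R (x * y)%g i j.
  rewrite block_matrix_mul; apply: block_matrix_ext => a b.
    by rewrite (matrix_coefM iv PP).
  by rewrite (matrix_coefM iu NP).
have B1 (R : comAlgType k) i j : B R 1%g i j = (i == j)%:R.
  apply: block_matrix1 => a b; first exact: (matrix_coef1 iv PP).
  exact: (matrix_coef1 iu NP).
pose mx (R : comAlgType k) (x : G R) : 'M[R]_#|basis_index U V| :=
  \matrix_(i, j) B R x (enum_val i) (enum_val j).
have mxM (R : comAlgType k) (x y : G R) : mx R x *m mx R y = mx R (x * y)%g.
  apply/matrixP => i j; rewrite !mxE -BM (reindex_onto enum_rank enum_val) /=.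
    by apply: eq_big => [q|q _]; rewrite ?enum_rankK ?eqxx // !mxE enum_rankK.
  by move=> q _; rewrite enum_valK.
have mx1 (R : comAlgType k) : mx R 1%g = 1%:M.
  by apply/matrixP => i j; rewrite !mxE B1 (inj_eq enum_val_inj).
have gl_proof (R : comAlgType k) (x : G R) :
    (mx R x *m mx R x^-1%g == 1%:M) && (mx R x^-1%g *m mx R x == 1%:M).
  by rewrite !mxM mulgV mulVg mx1 eqxx.
pose gl (R : comAlgType k) (x : G R) : GL R #|basis_index U V| :=
  @MkGL R _ (mx R x, mx R x^-1%g) (gl_proof R x).
have glE (R : comAlgType k) (x : G R) i j :
    gl_mx (gl R x) (enum_rank i) (enum_rank j) = B R x i j.
  by rewrite mxE !enum_rankK.
pose t := structure_tensor T.
have st_proof (R : comAlgType k) (x : G R) : gl R x \in fixes t (R := R).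
  apply/fixes_structure_tensor => i j l.
  have /(block_multiplicative la0) BT :=
    translation_block_morphism iu DP PP vE muE wE x.
  under [LHS]eq_bigr => p _ do rewrite glE.
  under [RHS]eq_bigr => q _ do under eq_bigr => s _ do rewrite !glE.
  exact: BT.
pose st (R : comAlgType k) (x : G R) : Stab t R := MkStab (st_proof R x).
have stM (R : comAlgType k) : {morph st R : x y / (x * y)%g}.
  by move=> x y; do 2!apply: val_inj; rewrite /= invgM -!mxM.
pose phi (R : comAlgType k) : {multiplicative G R -> Stab t R} :=
  HB.pack (st R) (isMultiplicative.Build (G R) (Stab t R) (st R) (stM R)).
have phi_inj (R : comAlgType k) : injective (phi R).
  move=> x y /(congr1 (fun a => gl_mx (stab_val a))) E.
  apply: ev_inj; apply: gen => l.
  (* The translation matrix determines x, since u_l(x) is the sum of the u_i(1) N_il(x). *)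
  rewrite -[x]mul1g -[y]mul1g !NP; apply: eq_bigr => i _; congr (_ * _).
  move/matrixP/(_ (enum_rank (inr (inr (inr (inr i)))))): E.
  move/(_ (enum_rank (inr (inr (inr (inr l)))))).
  by rewrite !glE.
have phi_surj (R : comAlgType k) (a : Stab t R) : exists x, phi R x = a.
  pose g i j := gl_mx (stab_val a) (enum_rank i) (enum_rank j).
  pose gi i j := gl_invmx (stab_val a) (enum_rank i) (enum_rank j).
  have sum_mx (X Y : 'M[R]_#|basis_index U V|) i j :
      \sum_q X (enum_rank i) (enum_rank q) * Y (enum_rank q) (enum_rank j) =
      (X *m Y) (enum_rank i) (enum_rank j).
    rewrite mxE (reindex_onto enum_rank enum_val) /=.
      by apply: eq_bigl => q; rewrite enum_rankK eqxx.
    by move=> q _; rewrite enum_valK.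
  have g_inv i j : \sum_q g i q * gi q j = (i == j)%:R.
    by rewrite sum_mx gl_mulmxV mxE (inj_eq enum_rank_inj).
  have gi_inv i j : \sum_q gi i q * g q j = (i == j)%:R.
    by rewrite sum_mx gl_mulVmx mxE (inj_eq enum_rank_inj).
  have /fixes_structure_tensor g_mul : stab_val a \in fixes t (R := R).
    by case: a {g gi g_inv gi_inv}.
  have [x [xP xN]] := block_morphism_point iu iv DP PP vE muE wE ext
    (automorphism_block_morphism la0 la_inj la_neq0 g_inv gi_inv g_mul).
  exists x.
  have E : mx R x = gl_mx (stab_val a).
    apply/matrixP => i j; rewrite mxE.
    rewrite -[in RHS](enum_valK i) -[in RHS](enum_valK j).
    rewrite -/(g _ _).
    rewrite (automorphism_block la0 la_inj la_neq0 g_inv gi_inv g_mul).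
    by apply: block_matrix_ext => p q; rewrite ?xP ?xN.
  do 2!apply: val_inj; rewrite /= [RHS]surjective_pairing -/(gl_mx _) -E.
  (* The second components agree because both are inverse to the same matrix. *)
  congr (_, _); rewrite -[LHS]mulmx1 -(gl_mulmxV (stab_val a)) -E mulmxA.
  by rewrite mxM mulVg mx1 mul1mx.
exists #|basis_index U V|, t, phi; split.
  move=> R; have [h hP] := choose_fun (phi_surj R).
  by exists h => // x; apply: phi_inj; rewrite hP.
move=> R S f x; do 2!apply: val_inj => /=.
have mx_map y : mx S (gf_map G f y) = map_mx f (mx R y).
  apply/matrixP => i j; rewrite !mxE /B.
  case: (enum_val i) (enum_val j) => [?|[?|[?|[?|?]]]] [?|[?|[?|[?|?]]]] /=;
    by rewrite ?rmorph0 ?rmorph1 ?rmorph_nat ?ev_map.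
have mapV : (gf_map G f x)^-1%g = gf_map G f x^-1%g.
  by apply: (mulgI (gf_map G f x)); rewrite mulgV -gmulfM mulgV gf_map1.
by rewrite mapV !mx_map.
Qed.

End CoordinateRing.

Theorem corollary3 (k : fieldType)
    (card_k : exists2 s : seq k, uniq s & (8 <= size s)%N)
    (G : algebraic_group k) :
  exists (n : nat) (t : 'cV[k]_(n * n * n)),
    gf_isomorphic G (stabilizer t).
Proof.
have [s us s8] := card_k.
have [A [A_ft [u u_rep]]] := ag_affine_ft G.
(* At most two entries of [s] are 0 or 1. The eigenvalues [la] are 1, required as [la 0], followed
   by four distinct scalars other than 0 and 1. *)
pose z : seq k := [:: 0; 1]; pose s' := [seq x <- s | x \notin z].
have s'4 : (4 <= size s')%N.
  have sz : (count (mem z) s <= 2)%N.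
    rewrite -size_filter; apply: (@uniq_leq_size _ _ z).
      exact: filter_uniq.
    by move=> x; rewrite mem_filter => /andP[].
  rewrite size_filter -(leq_add2l (count (mem z) s)) (count_predC (mem z) s).
  by apply: leq_trans s8; rewrite (leq_trans (leq_add sz (leqnn 4))).
have us' : uniq (1 :: s').
  by rewrite /= filter_uniq // mem_filter /z !inE eqxx orbT.
pose e := 1 :: s'; have ls i : (i < 5)%N -> (i < size e)%N.
  by move=> /leq_trans; apply; rewrite /= ltnS.
apply: (stabilizer_isomorphic u_rep A_ft (la := nth 0 e)) => //
  [i j i5 j5|i i5].
  by move/eqP; rewrite nth_uniq ?ls // => /eqP.
have := mem_nth 0 (ls i i5); rewrite inE => /predU1P[->|].
  exact: oner_neq0.
by rewrite mem_filter /z !inE negb_or => /andP[/andP[]].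
Qed.
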